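(* Let $\mathcal{H}$ be a complex separable infinite-dimensional Hilbert space and let $T$ be a bounded linear operator on $\mathcal{H}$. (i) If $T$ is a contraction and $T^*$ is strongly stable, then $$\gamma_p(T)=\dim\overline{(I_{\mathcal{H}}-TT^* )(\mathcal{H})}.$$ (ii) If $T$ is similar to a contraction and $T^*$ is strongly stable, then $$\gamma(T)=\min\{\dim\overline{(I_{\mathcal{H}}-QQ^* )(\mathcal{H})} : Q \text{ is a contraction on } \mathcal{H} \text{ similar to } T\}.$$ Moreover, in both cases, the index is attained by a linearly independent set of generators (Parseval generators in case (i), generators in case (ii)).
   Context: A countable family $\{x_k\}_k$ in $\mathcal{H}$ is a frame of $\mathcal{H}$ if there are $A,B>0$ with $A\|x\|^2\leqslant\sum_k|\langle x,x_k\rangle|^2\leqslant B\|x\|^2$ for all $x\in\mathcal{H}$, and a Parseval frame if one can take $A=B=1$. For $T$ bounded on $\mathcal{H}$, an at most countable collection of non-zero vectors $\{v_i\}_{i\in I}\subseteq\mathcal{H}$ is a set of generators (resp. Parseval generators) for $T$ if $\{T^nv_i\}_{i\in I,n\geqslant0}$ is a frame (resp. Parseval frame) of $\mathcal{H}$. The frame index $\gamma(T)$ is the minimal $d\in\mathbb{N}$ such that there is a set of $d$ generators for $T$, if a finite set of generators exists; $\gamma(T)=0$ if $T$ has no set of generators; $\gamma(T)=+\infty$ if $T$ has a set of generators but no finite one. The Parseval frame index $\gamma_p(T)$ is defined in the same way with Parseval generators in place of generators. Infinite dimension (Hilbert spaces being separable) is identified with the value $+\infty$; accordingly, when the index is $+\infty$,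 ''attained'' means attained by a countably infinite set. A bounded operator $T$ is a contraction if $\|T\|\leqslant1$, and is strongly stable if $T^nv\to0$ for all $v$. Operators $T_1$ on $\mathcal{H}_1$ and $T_2$ on $\mathcal{H}_2$ are similar if $VT_1V^{-1}=T_2$ for some bounded invertible $V:\mathcal{H}_1\to\mathcal{H}_2$. *)

(* Defs.v *)
From HB Require Import structures.
From mathcomp Require Import all_boot all_order all_algebra.
From mathcomp Require Import sesquilinear complex.
From mathcomp Require Import all_classical all_reals all_analysis.

Set Implicit Arguments.
Unset Strict Implicit.
Unset Printing Implicit Defensive.
Import Order.TTheory GRing.Theory Num.Theory.
Import numFieldNormedType.Exports.

Local Open Scope classical_set_scope.
Local Open Scope ring_scope.
Local Open Scope complex_scope.

(* A complex Hilbert space is a complete normed module over R[i] whose norm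
   comes from an inner product, linear in its first argument.  Norms of
   normed modules over R[i] are R[i]-valued, hence [rnorm] below. *)
HB.mixin Record isHilbert (R : realType) H of CompleteNormedModule R[i] H := {
  inner : {dot H for Num.conj};
  inner_norm : forall x : H, inner x x = `|x| ^+ 2 }.

#[short(type="hilbertType")]
HB.structure Definition Hilbert (R : realType) :=
  { H of CompleteNormedModule R[i] H & isHilbert R H }.

Variant enat := EFinite of nat | EInfinite.

Definition enat_le (a b : enat) : bool :=
  match a, b with
  | _, EInfinite => true
  | EFinite m, EFinite n => (m <= n)%N
  | EInfinite, EFinite _ => false
  end.

Definition is_min (S : set enat) (m : enat) : Prop :=
  S m /\ forall k, S k -> enat_le m k.

(* The least n satisfying P, or e if there is none. *)
Definition least_or (P : nat -> Prop) (e : enat) : enat :=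
  if pselect (exists n, `[< P n >]) is left exP then EFinite (ex_minn exP)
  else e.

Section hilbert_notions.
Variables (R : realType) (H : hilbertType R).

Definition rnorm (x : H) : R := complex.Re `|x|.

Definition separable_space : Prop := exists2 D : set H, countable D & dense D.

Definition lin_indep (J : countType) (v : J -> H) : Prop :=
  forall (s : seq J) (c : J -> R[i]), uniq s ->
    \sum_(j <- s) c j *: v j = 0 -> forall j, j \in s -> c j = 0.

Definition spans (n : nat) (v : 'I_n -> H) (W : set H) : Prop :=
  W = range (fun c : 'I_n -> R[i] => \sum_(i < n) c i *: v i).

(* Dimension of a linear subspace, all infinite dimensions being identified. *)
Definition hdim (W : set H) : enat :=
  least_or (fun n => exists2 v : 'I_n -> H, lin_indep v & spans v W) EInfinite.

Definition is_frame (K : countType) (x : K -> H) : Prop :=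
  exists A B : R, [/\ 0 < A, 0 < B & forall y : H,
    ((A * rnorm y ^+ 2)%:E
       <= \esum_(k in [set: K]) ((complex.Re `|inner y (x k)|) ^+ 2)%:E)%E /\
    (\esum_(k in [set: K]) ((complex.Re `|inner y (x k)|) ^+ 2)%:E
       <= (B * rnorm y ^+ 2)%:E)%E].

Definition is_parseval_frame (K : countType) (x : K -> H) : Prop :=
  forall y : H,
    (\esum_(k in [set: K]) ((complex.Re `|inner y (x k)|) ^+ 2)%:E
       = (rnorm y ^+ 2)%:E)%E.

Definition orbits (T : H -> H) (J : countType) (v : J -> H) (p : J * nat) : H :=
  iter p.2 T (v p.1).

Definition generators (T : H -> H) (J : countType) (v : J -> H) : Prop :=
  (forall j, v j != 0) /\ is_frame (orbits T v).

Definition parseval_generators (T : H -> H) (J : countType) (v : J -> H)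
  : Prop :=
  (forall j, v j != 0) /\ is_parseval_frame (orbits T v).

(* Collections of vectors are families, so repetitions are allowed; a set of n
   vectors is a family over 'I_n. The value is 0 when no countable family
   satisfies G. *)
Definition generator_index (G : forall J : countType, (J -> H) -> Prop)
  : enat :=
  least_or (fun n => exists v : 'I_n -> H, G 'I_n v)
    (if `[< exists (J : countType) (v : J -> H), G J v >] then EInfinite
     else EFinite 0).

Definition frame_index (T : H -> H) : enat := generator_index (generators T).

Definition parseval_frame_index (T : H -> H) : enat :=
  generator_index (parseval_generators T).

Definition attained_lin_indep (G : forall J : countType, (J -> H) -> Prop)
    (d : enat) : Prop :=
  match d with
  | EFinite n => exists2 v : 'I_n -> H, G 'I_n v & lin_indep v
  | EInfinite => exists2 v : nat -> H, G nat v & lin_indep v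
  end.

Definition strongly_stable (T : H -> H) : Prop :=
  forall v : H, (fun n => iter n T v) @ \oo --> (0 : H).

(* The Riesz representation theorem makes the chosen vector exist (and it is
   unique) when T is linear and bounded; 0 is a default value otherwise. *)
Definition adjoint (T : H -> H) (y : H) : H :=
  xget 0 [set z | forall x : H, inner (T x) y = inner x z].

Definition defect_range (T : H -> H) : set H :=
  range (fun x : H => x - T (adjoint T x)).

End hilbert_notions.

Section operators.
Variable R : realType.

Definition opnorm (H1 H2 : hilbertType R) (T : H1 -> H2) : \bar R :=
  ereal_sup [set (rnorm (T x))%:E | x in [set x : H1 | rnorm x <= 1]].

Definition bounded_op (H1 H2 : hilbertType R) (T : H1 -> H2) : Prop :=
  (opnorm T < +oo)%E.

Definition contraction_op (H : hilbertType R) (T : H -> H) : Prop :=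
  (opnorm T <= 1)%E.

Definition similar_ops (H1 H2 : hilbertType R) (T1 : H1 -> H1) (T2 : H2 -> H2)
  : Prop :=
  exists (V : {linear H1 -> H2}) (W : {linear H2 -> H1}),
    [/\ bounded_op V, bounded_op W, cancel V W, cancel W V &
        forall x, V (T1 (W x)) = T2 x].

Definition similar_to_contraction (H : hilbertType R) (T : H -> H) : Prop :=
  exists (H' : hilbertType R) (Q : {linear H' -> H'}),
    contraction_op Q /\ similar_ops T Q.

End operators.

(* Main.v *)
Require Import Defs.
From HB Require Import structures.
From mathcomp Require Import all_boot all_order all_algebra.
From mathcomp Require Import sesquilinear complex.
From mathcomp Require Import all_classical all_reals all_analysis.
From mathcomp Require Import ring lra.
Import Order.TTheory GRing.Theory Num.Theory.
Import numFieldNormedType.Exports.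
Local Open Scope classical_set_scope.
Local Open Scope ring_scope.

Set Implicit Arguments.
Unset Strict Implicit.
Unset Printing Implicit Defensive.

(** Write T' for the adjoint of T, D = I - T T' and [x, y] = <D x, y>.

    When T is a contraction, the form [x, y] = <x, y> - <T' x, T' y> is
    positive semi-definite.  A family T^n v_j is a Parseval frame when the sum
    over n and j of |<T'^n y, v_j>|^2 is |y|^2 for every y.  Subtracting this
    identity at T' y from the one at y leaves
      sum_j |<y, v_j>|^2 = |y|^2 - |T' y|^2 = [y, y],
    and conversely this last identity, summed along the orbit of y under T',
    telescopes to |y|^2 because T'^n y tends to 0 ([parseval_defectP]).  So
    Parseval generators are the families that resolve the form [x, y].  The
    usual choice is the image under the square root of D of an orthonormal
    basis; the proof below avoids square roots.  Gram-Schmidt for the form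
    [x, y], applied to a dense sequence, yields vectors f_j that are
    orthonormal for it and satisfy [y, y] = sum_j |[y, f_j]|^2
    ([orthonormal_basis_exists]); since [y, f_j] = <y, D f_j>, the vectors
    D f_j resolve the form.  They are independent because they are dual to the
    f_j, and they lie in the range of D, whose closure they span when they are
    finitely many.  No smaller family resolves the form: with fewer vectors
    than f_j, some non-trivial combination y of the f_j would be orthogonal to
    all of them, and then [y, y] = 0 ([defect_index]).

    For the second part, a similarity carries Parseval generators of a
    contraction Q to generators of T, independent if the first ones are
    ([similar_generators]); hence the index of T is at most the defect
    dimension of Q.  Conversely, let T^n v_i be a frame and let b(x, y) be the
    sum of <x, T^n v_i> <T^n v_i, y>, an inner product equivalent to the given
    one.  Equivalent inner products on a separable space are intertwined by a
    bounded invertible operator U, which sends an orthonormal basis of one to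
    an orthonormal basis of the other ([coercive_isometry]).  Then U' T^n v_i
    is a Parseval frame, it is the orbit of U' v_i under Q = U' T (U')^-1, and
    an operator with Parseval generators is a contraction
    ([generators_similar_parseval]); by the first part the defect dimension of
    Q is at most the number of the v_i.  The same operator U shows that an
    operator similar to a contraction of some other Hilbert space is similar
    to a contraction of H ([similar_to_contraction_same_space]).  *)

(** * Semi-inner products and Gram-Schmidt *)

(** Degenerate forms are allowed: the defect form of a contraction has a
    kernel in general. *)
Record semi_inner (C : numClosedFieldType) (E : lmodType C) (b : E -> E -> C)
  : Prop := SemiInner {
  siP : forall a x y z, b (a *: x + y) z = a * b x z + b y z;
  siC : forall x y, b y x = (b x y)^*;
  si_ge0 : forall x, 0 <= b x x }.

Section SemiInner.
Variables (C : numClosedFieldType) (E : lmodType C) (b : E -> E -> C).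
Hypothesis hb : semi_inner b.

Lemma si0l z : b 0 z = 0.
Proof.
apply: (@addrI _ (b 0 z)); rewrite addr0.
by have := siP hb 1 0 0 z; rewrite scaler0 addr0 mul1r => <-.
Qed.

Lemma siDl x y z : b (x + y) z = b x z + b y z.
Proof. by rewrite -[x in LHS]scale1r (siP hb) mul1r. Qed.

Lemma siZl a x z : b (a *: x) z = a * b x z.
Proof. by rewrite -[a *: x]addr0 (siP hb) si0l addr0. Qed.

Lemma siNl x z : b (- x) z = - b x z.
Proof. by rewrite -scaleN1r siZl mulN1r. Qed.

Lemma siBl x y z : b (x - y) z = b x z - b y z.
Proof. by rewrite siDl siNl. Qed.

Lemma si_suml I (r : seq I) (P : pred I) (F : I -> E) z :
  b (\sum_(i <- r | P i) F i) z = \sum_(i <- r | P i) b (F i) z.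
Proof. by apply: (big_morph (b^~ z)) => [x y|]; rewrite (siDl, si0l). Qed.

Lemma si0r z : b z 0 = 0.
Proof. by rewrite (siC hb) si0l conjC0. Qed.

Lemma siDr x y z : b z (x + y) = b z x + b z y.
Proof. by rewrite (siC hb) siDl rmorphD /= -!(siC hb). Qed.

Lemma siZr a x z : b z (a *: x) = a^* * b z x.
Proof. by rewrite (siC hb) siZl rmorphM /= -(siC hb). Qed.

Lemma siNr x z : b z (- x) = - b z x.
Proof. by rewrite (siC hb) siNl rmorphN /= -(siC hb). Qed.

Lemma siBr x y z : b z (x - y) = b z x - b z y.
Proof. by rewrite siDr siNr. Qed.

Lemma si_sumr I (r : seq I) (P : pred I) (F : I -> E) z :
  b z (\sum_(i <- r | P i) F i) = \sum_(i <- r | P i) b z (F i).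
Proof. by apply: (big_morph (b z)) => [x y|]; rewrite (siDr, si0r). Qed.

Lemma siZ a x : b (a *: x) (a *: x) = `|a| ^+ 2 * b x x.
Proof. by rewrite siZl siZr mulrA normCK. Qed.

(** The square of x - t y is nonnegative for every t; the optimal t gives the
    inequality when b y y is not 0, and otherwise t is used to make that
    square negative unless b x y = 0. *)
Lemma si_cauchy_schwarz x y : `|b x y| ^+ 2 <= b x x * b y y.
Proof.
have key t : 0 <= b x x - t * b y x - t^* * (b x y - t * b y y).
  by have := si_ge0 hb (x - t *: y); rewrite siBr siZr !siBl !siZl.
have [y0|y0] := eqVneq (b y y) 0; last first.
  have y_gt0 : 0 < b y y by rewrite lt_def y0 (si_ge0 hb).
  have := key (b x y / b y y).
  rewrite divfK // subrr mulr0 subr0 (siC hb x y) mulrAC -normCK.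
  by rewrite subr_ge0 ler_pdivrMr.
rewrite y0 mulr0.
have [->|n0] := eqVneq (b x y) 0; first by rewrite normr0 expr0n.
(* the square of x - t y is affine in t; this t makes it equal to -1 *)
have {key} := key ((b x x + 1) / (2 * b y x)).
have n0' : b y x != 0 by rewrite (siC hb) fmorph_eq0.
rewrite y0 mulr0 subr0 invfM -!mulrA mulVf // mulr1.
rewrite (_ : (_ * _)^* * b x y = (b x x + 1) / 2); last first.
  rewrite !rmorphM rmorphD !fmorphV rmorph1 rmorph_nat /= -!(siC hb).
  by rewrite -!mulrA mulVf // mulr1.
rewrite -addrA -opprD -splitr opprD addrA subrr sub0r.
by rewrite oppr_ge0 ler10.
Qed.

Lemma si_null x y : b x x = 0 -> b x y = 0.
Proof.
move=> x0; apply/eqP; have := si_cauchy_schwarz x y.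
by rewrite x0 mul0r -normr_eq0 -sqrf_eq0 eq_le exprn_ge0 // andbT.
Qed.

Lemma si_addnull u r : b r r = 0 -> b (u + r) (u + r) = b u u.
Proof.
move=> r0; rewrite siDl !siDr r0 [b u r](siC hb) !(si_null _ r0) conjC0.
by rewrite !addr0.
Qed.

Lemma si_polarization x y : b x y =
  4^-1 * (b (x + y) (x + y) - b (x - y) (x - y) +
          'i * (b (x + 'i *: y) (x + 'i *: y) - b (x - 'i *: y) (x - 'i *: y))).
Proof.
rewrite !siDl !siDr !siNl !siNr !siZl !siZr conjCi.
have := sqrCi C; set j := 'i; set p := b x x; set q := b x y; set r := b y x.
set s := b y y => jj.
transitivity (4^-1 * (2 * (q + r) - 2 * j ^+ 2 * (q - r))).
  by rewrite jj; field.
by congr (_ * _); ring.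
Qed.

End SemiInner.

Section GramSchmidt.
Variables (C : numClosedFieldType) (E : lmodType C) (b : E -> E -> C).
Variable y : nat -> E.

(** Dividing by the square root of 0 gives 0, so a vector that adds nothing to
    its predecessors is sent to 0. *)
Definition si_normalize (r : E) : E := (sqrtC (b r r))^-1 *: r.

(** The list of the first n vectors, built with its last vector at the end, as
    each vector depends on all the previous ones. *)
Fixpoint gs_prefix (n : nat) : seq E :=
  if n is m.+1 then
    let s := gs_prefix m in
    rcons s (si_normalize (y m - \sum_(h <- s) b (y m) h *: h))
  else [::].

Definition gram_schmidt (n : nat) : E := last 0 (gs_prefix n.+1).

Local Notation g := gram_schmidt.

Definition si_proj (f : nat -> E) (N : nat) (x : E) : E :=
  \sum_(k < N) b x (f k) *: f k.

Lemma gs_prefixE n : gs_prefix n = mkseq g n.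
Proof.
by elim: n => // n IHn; rewrite mkseqS -IHn /g /= last_rcons.
Qed.

Lemma gram_schmidtE n : g n = si_normalize (y n - si_proj g n (y n)).
Proof.
rewrite {1}/g /= last_rcons gs_prefixE big_map /si_proj.
by rewrite -[n in iota 0 n]subn0 -/(index_iota 0 n) big_mkord.
Qed.

Hypothesis hb : semi_inner b.

Lemma gs_norm01 n : g n = 0 \/ b (g n) (g n) = 1.
Proof.
rewrite gram_schmidtE /si_normalize; set r := _ - _.
have [r0|r0] := eqVneq (b r r) 0.
  by left; rewrite r0 sqrtC0 invr0 scale0r.
right; rewrite (siZ hb) normfV exprVn (ger0_norm _) ?sqrtC_ge0 ?(si_ge0 hb) //.
by rewrite sqrtCK mulVf.
Qed.

(** Uniform treatment of the two cases: Bessel's computation uses only this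
    identity, which a zero vector satisfies as well as a unit vector. *)
Lemma gs_norm_mul x n : b x (g n) * b (g n) (g n) = b x (g n).
Proof. by have [->|->] := gs_norm01 n; rewrite ?mulr1 // !(si0r hb) mul0r. Qed.

Lemma gs_orth i j : i != j -> b (g i) (g j) = 0.
Proof.
wlog ij : i j / (j < i)%N.
  move=> W; rewrite neq_ltn => /orP[] ij; last by apply: W; rewrite ?gtn_eqF.
  by rewrite (siC hb) W ?conjC0 // gtn_eqF.
move=> _; elim/ltn_ind: i j ij => n IHn j jn.
rewrite gram_schmidtE /si_normalize (siZl hb).
suff -> : b (y n - si_proj g n (y n)) (g j) = 0 by rewrite mulr0.
rewrite (siBl hb) (si_suml hb).
rewrite (bigD1 (Ordinal jn)) //= big1 ?addr0 => [|k kj].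
  by rewrite (siZl hb) gs_norm_mul subrr.
rewrite (siZl hb); have {kj} : val k != j by [].
rewrite neq_ltn => /orP[] kj.
  by rewrite [b (g k) _](siC hb) (IHn j) // conjC0 mulr0.
by rewrite IHn // mulr0.
Qed.

Lemma gs_residual_null n :
  let x := y n - si_proj g n.+1 (y n) in b x x = 0.
Proof.
rewrite /si_proj big_ord_recr /= opprD addrA -/(si_proj g n (y n)).
have := gram_schmidtE n; set r := y n - _ => gE.
have -> : b (y n) (g n) = b r (g n).
  rewrite (siBl hb) (si_suml hb) big1 ?subr0 // => k _.
  by rewrite (siZl hb) gs_orth ?mulr0 // ltn_eqF.
rewrite gE /si_normalize; set s := sqrtC _; rewrite (siZr hb) scalerA.
have [r0|r0] := eqVneq (b r r) 0.
  by rewrite r0 mulr0 mul0r scale0r subr0.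
have s0 : s != 0 by rewrite sqrtC_eq0.
have s_ge0 : 0 <= s by rewrite sqrtC_ge0 (si_ge0 hb).
rewrite fmorphV /= (geC0_conj s_ge0) -[b r r]sqrtCK -/s.
by rewrite expr2 mulKf // mulfV // scale1r subrr (si0l hb).
Qed.

End GramSchmidt.

Section Bessel.
Variables (C : numClosedFieldType) (E : lmodType C) (b : E -> E -> C).
Hypothesis hb : semi_inner b.
Variable f : nat -> E.
Hypothesis forth : forall i j, i != j -> b (f i) (f j) = 0.
Hypothesis fnorm : forall x n, b x (f n) * b (f n) (f n) = b x (f n).

Lemma si_orth_sum (c : nat -> C) m n :
  let s := \sum_(m <= k < n) c k *: f k in
  b s s = \sum_(m <= k < n) `|c k| ^+ 2 * b (f k) (f k).
Proof.
rewrite /= (si_suml hb); apply: eq_big_nat => k kmn.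
rewrite (si_sumr hb) (bigD1_seq k) ?mem_index_iota ?iota_uniq //= big1 ?addr0.
  by rewrite (siZl hb) (siZr hb) mulrA normCK.
by move=> j jk; rewrite (siZl hb) (siZr hb) forth ?mulr0 // eq_sym.
Qed.

Lemma si_bessel N x : let r := x - si_proj b f N x in
  b r r = b x x - \sum_(k < N) `|b x (f k)| ^+ 2.
Proof.
rewrite /=; set p := si_proj _ _ _ _.
have bxp : b x p = \sum_(k < N) `|b x (f k)| ^+ 2.
  rewrite (si_sumr hb); apply: eq_bigr => k _.
  by rewrite (siZr hb) mulrC normCK.
have bpp : b p p = \sum_(k < N) `|b x (f k)| ^+ 2.
  have := si_orth_sum (fun k => b x (f k)) 0 N; rewrite /= !big_mkord => ->.
  by apply: eq_bigr => k _; rewrite normCK mulrAC fnorm.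
have bpx : b p x = \sum_(k < N) `|b x (f k)| ^+ 2.
  rewrite (siC hb) bxp rmorph_sum; apply: eq_bigr => k _.
  by rewrite /= geC0_conj ?exprn_ge0.
by rewrite (siBl hb) !(siBr hb) bxp bpx bpp subrr subr0.
Qed.

Lemma si_bessel_le N x : \sum_(k < N) `|b x (f k)| ^+ 2 <= b x x.
Proof. by rewrite -subr_ge0 -si_bessel (si_ge0 hb). Qed.

End Bessel.

(** The error of the projection of x is that of x - y n up to the residual of
    y n, which is a null vector. *)
Lemma gs_approx (C : numClosedFieldType) (E : lmodType C) (b : E -> E -> C)
  (y : nat -> E) : semi_inner b -> forall n N x, (n < N)%N ->
  b x x - \sum_(k < N) `|b x (gram_schmidt b y k)| ^+ 2
    <= b (x - y n) (x - y n).
Proof.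
move=> hb n N x nN; set g := gram_schmidt b y.
have go i j : i != j -> b (g i) (g j) = 0 by exact: gs_orth.
have gn z k : b z (g k) * b (g k) (g k) = b z (g k) by exact: gs_norm_mul.
rewrite -(si_bessel hb go gn).
have -> : x - si_proj b g N x =
    (x - y n) - si_proj b g N (x - y n) + (y n - si_proj b g N (y n)).
  rewrite addrACA subrK; congr (_ + _); rewrite -opprD; congr (- _).
  rewrite -big_split /=; apply: eq_bigr => k _.
  by rewrite -scalerDl -(siDl hb) subrK.
have null_n : let r := y n - si_proj b g N (y n) in b r r = 0.
  apply/eqP; rewrite /= (si_bessel hb go gn) eq_le subr_ge0.
  rewrite (si_bessel_le hb go gn) andbT.
  have := gs_residual_null y hb n.
  rewrite /= -/g (si_bessel hb go gn) => null; rewrite -[leRHS]null.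
  rewrite lerD2l lerN2 (big_ord_widen _ (fun k => `|b (y n) (g k)| ^+ 2) nN).
  rewrite [leLHS]big_mkcond /=.
  by apply: ler_sum => k _; case: ifP => // _; rewrite exprn_ge0.
rewrite (si_addnull hb _ null_n) (si_bessel hb go gn) gerBl.
by apply: sumr_ge0 => k _; rewrite exprn_ge0.
Qed.

(** * Parseval's identity over the real numbers *)
Section Reals.
Variable R : realType.
Implicit Types (z : R[i]) (u : nat -> R).

Definition sqn z : R := complex.Re `|z| ^+ 2.

Lemma Re_ge0K z : 0 <= z -> (complex.Re z)%:C%C = z.
Proof. by move=> z0; rewrite RRe_real ?ger0_real. Qed.

Lemma Re_ge0 z : 0 <= z -> 0 <= complex.Re z.
Proof. by move=> z0; rewrite -ler0c Re_ge0K. Qed.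

Lemma ReD : {morph (@complex.Re R) : x y / x + y}.
Proof. by case=> ? ? []. Qed.

Lemma ReN : {morph (@complex.Re R) : x / - x}.
Proof. by case. Qed.


Lemma sqnE z : (sqn z)%:C%C = `|z| ^+ 2.
Proof. by rewrite /sqn -[in RHS](Re_ge0K (normr_ge0 z)) rmorphXn. Qed.

Lemma sqn_ge0 z : 0 <= sqn z.
Proof. exact: sqr_ge0. Qed.

Lemma sqn0 : sqn 0 = 0.
Proof. by apply: complexI; rewrite sqnE normr0 expr0n. Qed.

Lemma sqn_eq0 z : sqn z = 0 -> z = 0.
Proof.
move=> e; apply/eqP; rewrite -normr_eq0 -sqrf_eq0 -sqnE e; exact/eqP.
Qed.

Lemma sqnC z : sqn z^* = sqn z.
Proof. by rewrite /sqn norm_conjC. Qed.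

Lemma sqn_ReIm z : sqn z = complex.Re z ^+ 2 + complex.Im z ^+ 2.
Proof. by apply: complexI; rewrite sqnE add_Re2_Im2. Qed.

Lemma sqn_real (x : R) : sqn x%:C%C = x ^+ 2.
Proof. by rewrite sqn_ReIm /= [0 ^+ 2]expr0n addr0. Qed.


Lemma sqnB_le (x y : R[i]) : sqn (x - y) <= 2 * (sqn x + sqn y).
Proof.
rewrite !sqn_ReIm; case: x y => [x1 x2] [y1 y2] /=.
by have := sqr_ge0 (x1 + y1); have := sqr_ge0 (x2 + y2); nra.
Qed.

Lemma esum_nat_eq u (l : R) : (forall k, 0 <= u k) ->
  (forall N, \sum_(k < N) u k <= l) ->
  (forall e, 0 < e -> exists N, l - e <= \sum_(k < N) u k) ->
  (\esum_(k in [set: nat]) (u k)%:E = l%:E)%E.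
Proof.
move=> u0 ule uge; rewrite -nneseries_esumT => [|k]; last by rewrite lee_fin.
have ue0 k : xpredT k -> (0 <= (u k)%:E)%E by rewrite lee_fin.
apply/eqP; rewrite eq_le; apply/andP; split.
  apply: lime_le; first by apply: is_cvg_nneseries => k _ ; apply: ue0.
  by apply: nearW => N; rewrite sumEFin lee_fin big_mkord ule.
apply/lee_addgt0Pr => e /uge[N lN].
rewrite -leeBlDr // -EFinB.
apply: (@le_trans _ _ (\sum_(0 <= k < N) (u k)%:E)%E).
  by rewrite sumEFin lee_fin big_mkord.
by apply: nneseries_lim_ge => k _ _; exact: ue0.
Qed.

Lemma esum_ord (n : nat) (F : 'I_n -> R) : (forall i, 0 <= F i) ->
  (\esum_(k in [set: 'I_n]) (F k)%:E = (\sum_(k < n) F k)%:E)%E.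
Proof.
move=> F0; rewrite esum_fset; last 2 first.
- exact: finite_finset.
- by move=> i _; rewrite lee_fin.
have -> : [set: 'I_n] = [set` index_enum 'I_n].
  by apply/seteqP; split => // i _; rewrite /= mem_index_enum.
by rewrite -fsbig_seq ?index_enum_uniq // sumEFin.
Qed.

End Reals.

(** Used to discard the zero vectors that Gram-Schmidt produces. *)
Lemma set_nat_enum (A : set nat) :
  (exists n (h : 'I_n -> nat), set_bij setT A h) \/
  (exists h : nat -> nat, set_bij setT A h).
Proof.
have [Afin|Ainf] := pselect (finite_set A).
  left; have /finite_seqP[s ->] := Afin.
  pose t := undup s; exists (size t), (fun i => nth 0%N t i).
  split => [i _ /=|i j _ _ /eqP|k /=].
  - by rewrite -(mem_undup s) mem_nth.
  - by rewrite nth_uniq ?undup_uniq // => /eqP/val_inj.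
  - rewrite -(mem_undup s) => kt.
    have kt' : (index k t < size t)%N by rewrite index_mem.
    by exists (Ordinal kt') => //=; rewrite nth_index.
right; apply/card_set_bijP; rewrite card_eq_sym.
exact/eq_card_nat/Ainf/countableP.
Qed.

Section OrthonormalBasis.
Variables (R : realType) (E : lmodType R[i]) (b : E -> E -> R[i]).

Definition qf (x : E) : R := complex.Re (b x x).

(** Completeness is expressed by Parseval's identity, which makes sense for a
    degenerate form. *)
Definition orthonormal_basis (J : countType) (f : J -> E) : Prop :=
  (forall i j, b (f i) (f j) = (i == j)%:R) /\
  forall x, (\esum_(k in [set: J]) (sqn (b x (f k)))%:E = (qf x)%:E)%E.

Hypothesis hb : semi_inner b.

Lemma qfE x : (qf x)%:C%C = b x x.
Proof. exact/Re_ge0K/(si_ge0 hb). Qed.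

Lemma qf_ge0 x : 0 <= qf x.
Proof. exact/Re_ge0/(si_ge0 hb). Qed.

Lemma qf0 : qf 0 = 0. Proof. by rewrite /qf (si0l hb). Qed.

Lemma qfZ a x : qf (a *: x) = sqn a * qf x.
Proof. by apply: complexI; rewrite rmorphM /= sqnE !qfE (siZ hb). Qed.

Lemma qfN x : qf (- x) = qf x.
Proof. by rewrite /qf (siNl hb) (siNr hb) opprK. Qed.

Lemma qf_parallelogram x y : qf (x + y) + qf (x - y) = 2 * (qf x + qf y).
Proof.
rewrite /qf !(siDl hb) !(siDr hb) !(siNl hb) !(siNr hb) opprK !(ReD, ReN).
lra.
Qed.

Lemma qfD_le x y : qf (x + y) <= 2 * (qf x + qf y).
Proof. by rewrite -qf_parallelogram lerDl qf_ge0. Qed.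

Lemma qf_cauchy_schwarz x y : sqn (b x y) <= qf x * qf y.
Proof. by rewrite -lecR sqnE rmorphM /= !qfE si_cauchy_schwarz. Qed.

Section Complete.
Variable y : nat -> E.
Hypothesis ydense : forall x (e : R), 0 < e -> exists n, qf (x - y n) < e.
Local Notation g := (gram_schmidt b y).

Let go i j : i != j -> b (g i) (g j) = 0.
Proof. exact: gs_orth. Qed.

Let gn x k : b x (g k) * b (g k) (g k) = b x (g k).
Proof. exact: gs_norm_mul. Qed.

Let sumC x N : (\sum_(k < N) sqn (b x (g k)))%:C%C =
  \sum_(k < N) `|b x (g k)| ^+ 2.
Proof. by rewrite rmorph_sum; apply: eq_bigr => k _; rewrite -sqnE. Qed.

Lemma gram_schmidt_complete x (e : R) : 0 < e ->
  exists N, qf (x - si_proj b g N x) < e.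
Proof.
move=> /(ydense x)[n xn]; exists n.+1; apply: le_lt_trans xn.
by rewrite -lecR !qfE (si_bessel hb go gn); apply: gs_approx.
Qed.

Lemma gram_schmidt_parseval x :
  (\esum_(k in [set: nat]) (sqn (b x (g k)))%:E = (qf x)%:E)%E.
Proof.
apply: esum_nat_eq => [k|N|e /(gram_schmidt_complete x)[N xN]].
- exact: sqn_ge0.
- by rewrite -lecR sumC qfE (si_bessel_le hb go gn).
exists N; rewrite lerBlDl -lerBlDr; apply: le_trans (ltW xN).
by rewrite -lecR rmorphB /= sumC !qfE (si_bessel hb go gn).
Qed.

Theorem orthonormal_basis_exists :
  (exists n (f : 'I_n -> E), orthonormal_basis f) \/
  (exists f : nat -> E, orthonormal_basis f).
Proof.
pose A := [set k | g k != 0].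
have transfer (J : countType) (h : J -> nat) :
    set_bij setT A h -> orthonormal_basis (g \o h).
  move=> hbij; split=> [i j|x].
    have [<-|ij] := eqVneq i j.
      have [e|//] := gs_norm01 y hb (h i).
      by have [hA _ _] := hbij; have := hA i I; rewrite /A /= e eqxx.
    apply: go; apply: contra_neq ij => hij.
    by have [_ hinj _] := hbij; apply: hinj hij; rewrite in_setT.
  rewrite -gram_schmidt_parseval [RHS](esumID A); last first.
    by move=> k _; rewrite lee_fin sqn_ge0.
  rewrite [X in (_ + X)%E]esum1 => [|k [_ /negP]]; last first.
    by rewrite negbK => /eqP ->; rewrite (si0r hb) sqn0.
  by rewrite adde0 setTI (reindex_esum _ _ _ _ hbij).
have [[n [h hbij]]|[h hbij]] := set_nat_enum A.
  by left; exists n, (g \o h); apply: transfer.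
by right; exists (g \o h); apply: transfer.
Qed.

End Complete.

End OrthonormalBasis.

(** * Elementary facts on Hilbert spaces *)
Section HilbertBasics.
Variables (R : realType) (H : hilbertType R).
Implicit Types (x y : H).

Local Notation nsq := (qf (@inner R H)).

Lemma inner_semi_inner : semi_inner (@inner R H).
Proof.
split=> [a x y z|x y|x].
- by rewrite linearPl.
- by rewrite hermC expr0 mul1r.
- by rewrite inner_norm exprn_ge0.
Qed.

Lemma rnormE x : (rnorm x)%:C%C = `|x|.
Proof. exact/Re_ge0K. Qed.

Lemma rnorm_ge0 x : 0 <= rnorm x.
Proof. exact: Re_ge0. Qed.

Lemma rnorm_sqr x : rnorm x ^+ 2 = nsq x.
Proof.
apply: complexI.
by rewrite rmorphXn /= rnormE (qfE inner_semi_inner) inner_norm.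
Qed.

Lemma nsq_eq0 x : nsq x = 0 -> x = 0.
Proof.
move=> /eqP; rewrite -rnorm_sqr sqrf_eq0 => /eqP x0.
by apply/eqP; rewrite -normr_eq0 -rnormE x0.
Qed.

Lemma nsq_lt x (e : R) : 0 <= e -> (nsq x < e ^+ 2) = (`|x| < e%:C%C).
Proof.
by move=> e0; rewrite -rnorm_sqr ltr_pXn2r ?nnegrE ?rnorm_ge0 // -rnormE ltcR.
Qed.

Lemma ball_nsq x y (e : R) : 0 < e -> nsq (x - y) < e ^+ 2 -> ball x e%:C%C y.
Proof. by move=> e0; rewrite nsq_lt ?ltW // -ball_normE. Qed.

Lemma nsq_ball x y (e : R[i]) : 0 < e -> ball x e y ->
  nsq (x - y) < complex.Re e ^+ 2.
Proof.
by move=> e0; rewrite nsq_lt ?Re_ge0 ?Re_ge0K ?ltW // -ball_normE.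
Qed.

Lemma inner_eq0 x : (forall y, inner x y = 0) -> x = 0.
Proof. by move=> /(_ x) x0; apply: nsq_eq0; rewrite /qf x0. Qed.

Lemma separable_seq : separable_space H ->
  exists y : nat -> H, forall x (e : R), 0 < e -> exists n, nsq (x - y n) < e.
Proof.
move=> [D /countable_injP[h hinj] Ddense].
exists (fun n => xget 0 [set x | D x /\ h x = n]) => x e e0.
have s0 : 0 < (Num.sqrt e)%:C%C by rewrite ltcR sqrtr_gt0.
have [z [zx Dz]] : ball x (Num.sqrt e)%:C%C `&` D !=set0.
  apply: Ddense; last exact: ball_open.
  by exists x; apply: ballxx.
exists (h z); case: xgetP => [w _ [Dw hw]|/(_ z)/not_andP[]//].
have <- : z = w by apply: hinj; rewrite ?inE.
by have := nsq_ball s0 zx; rewrite sqr_sqrtr // ltW.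
Qed.

Lemma hilbert_complete (u : nat -> H) :
  (forall e : R, 0 < e ->
    exists N, forall n, (N <= n)%N -> nsq (u N - u n) < e) ->
  exists z, forall e : R, 0 < e ->
    exists N, forall n, (N <= n)%N -> nsq (z - u n) < e.
Proof.
move=> ucauchy.
have ucvg : cvg (u @ \oo).
  apply: cauchy_cvg; apply: cauchy_exP => e e0.
  have re0 : 0 < complex.Re e by rewrite -ltcR Re_ge0K ?ltW.
  have [N uN] := ucauchy _ (exprn_gt0 2 re0).
  exists (u N); exists N => // n /= /uN; rewrite -{2}(Re_ge0K (ltW e0)).
  exact: ball_nsq.
exists (lim (u @ \oo)) => e e0.
have s0 : 0 < (Num.sqrt e)%:C%C by rewrite ltcR sqrtr_gt0.
have /cvg_ballP/(_ _ s0)[N _ uN] := ucvg.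
exists N => n /uN /(nsq_ball s0); by rewrite sqr_sqrtr // ltW.
Qed.

End HilbertBasics.

(** * Bounded operators *)
Lemma linear_pack (K : pzRingType) (U V : lmodType K) (f : U -> V) :
  linear f -> exists g : {linear U -> V}, g =1 f.
Proof.
move=> flin; pose m := GRing.isLinear.Build K U V *:%R f flin.
by exists (HB.pack_for {linear U -> V} f m).
Qed.

Section Bounded.
Variables (R : realType).

Lemma opnorm_leP (H1 H2 : hilbertType R) (T : {linear H1 -> H2}) (M : R) :
  0 <= M ->
  (opnorm T <= M%:E)%E <->
  forall x, qf (@inner R H2) (T x) <= M ^+ 2 * qf (@inner R H1) x.
Proof.
move=> M0; split=> [TM x|TM].
  have [x0|x0] := eqVneq (rnorm x) 0.
    have -> : x = 0 by apply: nsq_eq0; rewrite -rnorm_sqr x0 expr0n.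
    by rewrite linear0 !(qf0 (@inner_semi_inner _ _)) mulr0.
  have xgt : 0 < rnorm x by rewrite lt_def x0 rnorm_ge0.
  have nZ (H : hilbertType R) (z : H) :
      rnorm ((rnorm x)^-1%:C%C *: z) = (rnorm x)^-1 * rnorm z.
    apply: complexI; rewrite rmorphM /= !rnormE normrZ; congr (_ * _).
    by rewrite ger0_norm // ler0c invr_ge0 ltW.
  have : ((rnorm (T ((rnorm x)^-1%:C%C *: x)))%:E <= M%:E)%E.
    apply: le_trans TM; apply: ereal_sup_ubound.
    by exists ((rnorm x)^-1%:C%C *: x) => //=; rewrite nZ mulVf.
  rewrite linearZ /= nZ lee_fin ler_pdivrMl // mulrC => TxM.
  by rewrite -!rnorm_sqr -exprMn lerXn2r // nnegrE ?mulr_ge0 ?rnorm_ge0.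
apply: ge_ereal_sup => _ [x /= x1 <-]; rewrite lee_fin.
rewrite -(@ler_pXn2r _ 2) ?nnegrE ?rnorm_ge0 // rnorm_sqr.
apply: le_trans (TM x) _; rewrite -rnorm_sqr -[leRHS]mulr1.
by rewrite ler_wpM2l ?exprn_ge0 // exprn_ile1 ?rnorm_ge0.
Qed.

Lemma contraction_opP (H : hilbertType R) (T : {linear H -> H}) :
  contraction_op T <->
  forall x, qf (@inner R H) (T x) <= qf (@inner R H) x.
Proof.
rewrite /contraction_op; split=> [/opnorm_leP h x|h].
  by have := h ler01 x; rewrite expr1n mul1r.
by apply/opnorm_leP => // x; rewrite expr1n mul1r.
Qed.

Lemma bounded_opP (H1 H2 : hilbertType R) (T : {linear H1 -> H2}) :
  bounded_op T <-> exists2 M : R, 0 < M &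
  forall x, qf (@inner R H2) (T x) <= M * qf (@inner R H1) x.
Proof.
rewrite /bounded_op; split=> [Tfin|[M M0 TM]].
  have [M M0 TM] : exists2 M : R, 0 <= M & (opnorm T <= M%:E)%E.
    move: Tfin; case: (opnorm T) => [r _|//|_].
      by exists (Num.max r 0); rewrite ?lee_fin le_max lexx ?orbT.
    by exists 0; rewrite ?leNye.
  have {}TM := (opnorm_leP T M0).1 TM.
  exists (M ^+ 2 + 1) => [|x]; first by rewrite ltr_wpDl ?exprn_ge0.
  apply: le_trans (TM x) _; rewrite ler_wpM2r ?lerDl //.
  exact/qf_ge0/inner_semi_inner.
apply: le_lt_trans (ltry (Num.sqrt M)).
apply: (opnorm_leP T (sqrtr_ge0 M)).2 => x.
by rewrite sqr_sqrtr ?TM // ltW.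
Qed.

End Bounded.

(** * The theorems of Riesz-Fischer and Riesz *)
Lemma bounded_sum_tail (R : realType) (u : nat -> R) (M : R) :
  (forall k, 0 <= u k) -> (forall N, \sum_(k < N) u k <= M) ->
  forall e, 0 < e ->
  exists N, forall n, (N <= n)%N -> \sum_(N <= k < n) u k < e.
Proof.
move=> u0 uM e e0; pose S := [set \sum_(k < N) u k | N in [set: nat]].
have Ssup : has_sup S.
  split; first by exists (\sum_(k < 0) u k), 0%N.
  by exists M => _ [N _ <-].
have [_ [N _ <-] Ne] := sup_adherent e0 Ssup.
exists N => n Nn; rewrite -(ltrD2l (\sum_(k < N) u k)).
rewrite -!(big_mkord xpredT u) -big_cat_nat //=.
apply: le_lt_trans (_ : sup S < _).
  by apply: ub_le_sup; [exact: Ssup.2|exists n => //; rewrite big_mkord].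
by rewrite -ltrBlDr -(big_mkord xpredT u) in Ne *.
Qed.

Section Coercive.
Variables (R : realType) (H : hilbertType R).
Local Notation nsq := (qf (@inner R H)).
Local Notation iH := (@inner_semi_inner R H).

(** The lower bound makes b definite and the space complete for it, the upper
    bound makes b continuous. *)
Definition coercive (b : H -> H -> R[i]) : Prop :=
  exists A B : R, [/\ 0 < A, 0 < B &
    forall x, A * nsq x <= qf b x /\ qf b x <= B * nsq x].

Lemma coercive_inner : coercive (@inner R H).
Proof. by exists 1, 1; split => // x; rewrite mul1r. Qed.

Lemma coercive_eq0 b x : coercive b -> qf b x = 0 -> x = 0.
Proof.
move=> [A [B [A0 _ AB]]] bx0; apply: nsq_eq0; apply/eqP.
have [+ _] := AB x; rewrite bx0 pmulr_rle0 // => xle.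
by rewrite eq_le xle qf_ge0 //; exact: iH.
Qed.

(** The f i may vanish, so that this applies to the raw output of
    Gram-Schmidt. *)
Theorem riesz_fischer (b : H -> H -> R[i]) (f : nat -> H) (c : nat -> R[i])
    (M : R) :
  semi_inner b -> coercive b -> (forall i j, i != j -> b (f i) (f j) = 0) ->
  (forall i, qf b (f i) <= 1) -> (forall N, \sum_(k < N) sqn (c k) <= M) ->
  exists z, forall k, b z (f k) = c k * b (f k) (f k).
Proof.
move=> hb [A [B [A0 B0 AB]]] forth fle1 cM.
pose s N := \sum_(0 <= k < N) c k *: f k.
have diff N n : (N <= n)%N -> s n - s N = \sum_(N <= k < n) c k *: f k.
  by move=> Nn; rewrite /s (big_cat_nat (leq0n N) Nn) /= addrAC subrr add0r.
have qdiff N n : (N <= n)%N ->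
    A * nsq (s N - s n) <= \sum_(N <= k < n) sqn (c k).
  move=> Nn; rewrite -(qfN iH) opprB diff //; apply: le_trans (AB _).1 _.
  rewrite -lecR (qfE hb) (si_orth_sum hb forth) rmorph_sum /=.
  apply: ler_sum => k _; rewrite sqnE -(qfE hb) -[leRHS]mulr1.
  by rewrite ler_wpM2l ?exprn_ge0 // lecR.
have [|z zlim] := @hilbert_complete R H s.
  move=> e e0.
  have [N sN] := bounded_sum_tail (fun k => sqn_ge0 (c k)) cM (mulr_gt0 A0 e0).
  exists N => n Nn; rewrite -(ltr_pM2l A0).
  exact: le_lt_trans (qdiff _ _ Nn) (sN _ Nn).
exists z => k; apply/eqP; rewrite -subr_eq0; apply/eqP.
apply: sqn_eq0; apply/eqP; rewrite eq_le sqn_ge0 andbT.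
apply/ler_addgt0Pr => e e0; rewrite add0r.
have [N zN] := zlim _ (divr_gt0 e0 B0).
have kN : (k < maxn N k.+1)%N by rewrite leq_max leqnn orbT.
have := zN (maxn N k.+1) (leq_maxl _ _); set n := maxn _ _ in kN *.
have <- : b (s n) (f k) = c k * b (f k) (f k).
  rewrite (si_suml hb) (bigD1_seq k) ?mem_index_iota ?iota_uniq //= big1.
    by rewrite (siZl hb) addr0.
  by move=> j jk; rewrite (siZl hb) forth // mulr0.
rewrite -(siBl hb) ltr_pdivlMr // mulrC => /ltW zn.
apply: le_trans (qf_cauchy_schwarz hb _ _) _.
apply: le_trans zn; apply: le_trans (AB _).2.
by rewrite -[leRHS]mulr1 ler_wpM2l ?(qf_ge0 hb).
Qed.

(** The representing vector is the sum of the conj (phi (g k)) g k for an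
    orthonormal sequence g; evaluating phi on its partial sums bounds the
    squares of the coefficients by M. *)
Theorem riesz_representation (phi : H -> R[i]) (M : R) :
  separable_space H -> 0 <= M ->
  (forall a x y, phi (a *: x + y) = a * phi x + phi y) ->
  (forall x, sqn (phi x) <= M * nsq x) ->
  exists z, forall x, phi x = inner x z.
Proof.
move=> /separable_seq[y ydense] M_ge0 plin pM.
set g := gram_schmidt (@inner R H) y.
have go i j : i != j -> inner (g i) (g j) = 0 by exact: (gs_orth y iH).
have p0 : phi 0 = 0.
  apply: sqn_eq0; apply/eqP; rewrite eq_le sqn_ge0 andbT.
  by rewrite (le_trans (pM 0)) // (qf0 iH) mulr0.
have psum I r (F : I -> H) (c : I -> R[i]) :
    phi (\sum_(i <- r) c i *: F i) = \sum_(i <- r) c i * phi (F i).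
  by elim/big_rec2: _ => // i a x _ <-; rewrite plin.
have gle1 k : nsq (g k) <= 1.
  have [e|e] := gs_norm01 y iH k; rewrite -/g in e.
    by rewrite e (qf0 iH) ler01.
  by rewrite /qf e.
pose c k := (phi (g k))^*.
pose S N := \sum_(k < N) sqn (c k).
have S0 N : 0 <= S N by apply: sumr_ge0 => k _; exact: sqn_ge0.
have cM N : S N <= M.
  (* phi w is the sum S N, and the square of w is at most S N *)
  pose w := \sum_(0 <= k < N) c k *: g k.
  have pw : phi w = (S N)%:C%C.
    rewrite psum rmorph_sum big_mkord; apply: eq_bigr => k _ /=.
    by rewrite sqnE normCK /c conjCK.
  have nw : nsq w <= S N.
    rewrite -lecR (qfE iH) (si_orth_sum iH go) rmorph_sum big_mkord /=.
    apply: ler_sum => k _; rewrite sqnE -(qfE iH) -[leRHS]mulr1.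
    by rewrite ler_wpM2l ?exprn_ge0 // lecR.
  have [->//|Sz] := eqVneq (S N) 0.
  have Spos : 0 < S N by rewrite lt_def Sz S0.
  rewrite -(ler_pM2r Spos) -expr2 -sqn_real -pw.
  by apply: le_trans (pM w) _; rewrite ler_wpM2l.
have [z zg] := riesz_fischer iH coercive_inner go gle1 cM.
have zgP k : inner (g k) z = phi (g k).
  rewrite (siC iH) zg rmorphM /= /c conjCK.
  have [e|e] := gs_norm01 y iH k; rewrite -/g in e; rewrite e.
    by rewrite p0 mul0r.
  by rewrite rmorph1 mulr1.
have zproj N x : inner (si_proj (@inner R H) g N x) z =
    phi (si_proj (@inner R H) g N x).
  rewrite /si_proj psum (si_suml iH); apply: eq_bigr => k _.
  by rewrite (siZl iH) zgP.
exists z => x; apply/eqP; rewrite -subr_eq0; apply/eqP.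
apply: sqn_eq0; apply/eqP; rewrite eq_le sqn_ge0 andbT.
apply/ler_addgt0Pr => e e0; rewrite add0r.
(* phi and the inner product with z agree on the projections of x, and K
   bounds their difference on what remains *)
pose K := 2 * (M + nsq z) + 1.
have K0 : 0 < K.
  by rewrite ltr_wpDl // mulr_ge0 // addr_ge0 // (qf_ge0 iH).
have [N xN] := gram_schmidt_complete iH ydense x (divr_gt0 e0 K0).
set p := si_proj _ _ N x in xN.
have -> : phi x - inner x z = phi (x - p) - inner (x - p) z.
  rewrite (siBl iH) zproj -/p [x - p]addrC -scaleN1r plin mulN1r.
  by ring.
move: xN; rewrite ltr_pdivlMr // => /ltW; apply: le_trans.
apply: le_trans (sqnB_le _ _) _.
have := pM (x - p); have := qf_cauchy_schwarz iH (x - p) z.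
have := qf_ge0 iH (x - p); rewrite /K; nra.
Qed.

End Coercive.

(** * Adjoints *)
Section Adjoint.
Variables (R : realType) (H : hilbertType R).
Local Notation nsq := (qf (@inner R H)).
Local Notation iH := (@inner_semi_inner R H).

Lemma inner_eq x y : (forall z : H, inner z x = inner z y) -> x = y.
Proof.
move=> xy; apply/eqP; rewrite -subr_eq0; apply/eqP/inner_eq0 => z.
by rewrite (siC iH) (siBr iH) xy subrr conjC0.
Qed.

Lemma adjoint_unique (T : H -> H) (y z : H) :
  (forall x, inner (T x) y = inner x z) -> adjoint T y = z.
Proof.
move=> Tz; rewrite /adjoint; case: xgetP => [w _ /= Tw|/(_ z)//].
by apply: inner_eq => x; rewrite -Tw Tz.
Qed.

Hypothesis Hsep : separable_space H.

Lemma adjointP (T : {linear H -> H}) x y : bounded_op T ->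
  inner (T x) y = inner x (adjoint T y).
Proof.
move=> /bounded_opP[M M0 TM].
have [z zP] : exists z, forall u, inner (T u) y = inner u z.
  apply: (@riesz_representation _ _ _ (M * nsq y)) => // [|a u v|u].
  - by rewrite mulr_ge0 ?(qf_ge0 iH) // ltW.
  - by rewrite linearP (siP iH).
  apply: le_trans (qf_cauchy_schwarz iH _ _) _.
  by rewrite mulrAC ler_wpM2r ?(qf_ge0 iH).
by rewrite zP (adjoint_unique zP).
Qed.

Lemma adjoint_linear (T : {linear H -> H}) : bounded_op T ->
  linear (adjoint T).
Proof.
move=> Tb a x y; apply: inner_eq => z.
by rewrite -adjointP // !(siDr iH) !(siZr iH) -!adjointP.
Qed.

Lemma adjoint_bound (T : {linear H -> H}) (M : R) : 0 <= M ->
  (forall x, nsq (T x) <= M * nsq x) ->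
  forall y, nsq (adjoint T y) <= M * nsq y.
Proof.
move=> M0 TM y; have Tb : bounded_op T.
  apply/bounded_opP; exists (M + 1) => [|x]; first by rewrite ltr_wpDl.
  by apply: le_trans (TM x) _; rewrite ler_wpM2r ?(qf_ge0 iH) // lerDl.
set s := adjoint T y.
have [s0|s0] := eqVneq (nsq s) 0.
  by rewrite s0 mulr_ge0 // (qf_ge0 iH).
have sgt : 0 < nsq s by rewrite lt_def s0 (qf_ge0 iH).
have sE : (nsq s)%:C%C = inner (T s) y by rewrite (adjointP _ _ Tb) (qfE iH).
rewrite -(ler_pM2l sgt) -expr2 -sqn_real sE.
apply: le_trans (qf_cauchy_schwarz iH _ _) _.
by rewrite mulrA [_ * M]mulrC ler_wpM2r ?(qf_ge0 iH).
Qed.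

Lemma adjoint_iter (T : {linear H -> H}) n x y : bounded_op T ->
  inner (iter n T x) y = inner x (iter n (adjoint T) y).
Proof.
by move=> Tb; elim: n y => // n IHn y; rewrite [LHS]/= adjointP // IHn -iterSr.
Qed.

End Adjoint.

(** * Linear independence and dimension *)
Lemma ex_row_kernel (F : fieldType) (m n : nat) (A : 'I_m -> 'I_n -> F) :
  (n < m)%N -> exists c : 'I_m -> F,
    (exists k, c k != 0) /\ forall j, \sum_k c k * A k j = 0.
Proof.
move=> nm; pose M := \matrix_(i < m, j < n) A i j.
have : kermx M != 0.
  rewrite -mxrank_eq0 mxrank_ker -lt0n subn_gt0.
  exact: leq_ltn_trans (rank_leq_col M) nm.
move=> /rowV0Pn[v /sub_kermxP vM v0].
exists (v 0); split.
  by have /rV0Pn[k vk] := v0; exists k.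
move=> j; have := congr1 (fun B : 'rV_n => B 0 j) vM.
rewrite !mxE => vMj; rewrite -[RHS]vMj.
by apply: eq_bigr => k _; rewrite mxE.
Qed.

Section LeastOr.
Variables (P : nat -> Prop) (e : enat).

Lemma least_orP n : P n -> exists2 m, least_or P e = EFinite m &
  P m /\ forall k, P k -> (m <= k)%N.
Proof.
move=> Pn; rewrite /least_or; case: pselect => [exP|[]]; last first.
  by exists n; apply/asboolP.
case: ex_minnP => m Pm mmin; exists m => //; split; first exact/asboolP.
by move=> k Pk; apply: mmin; apply/asboolP.
Qed.

Lemma least_or_none : (forall n, ~ P n) -> least_or P e = e.
Proof.
move=> nP; rewrite /least_or; case: pselect => // exP.
by have [n /asboolP/nP] := exP.
Qed.

Lemma least_orE n : P n -> (forall k, P k -> (n <= k)%N) ->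
  least_or P e = EFinite n.
Proof.
move=> Pn nmin; have [m -> [Pm mmin]] := least_orP Pn.
by congr EFinite; apply/eqP; rewrite eqn_leq mmin // nmin.
Qed.

End LeastOr.

Section Dimension.
Variables (R : realType) (H : hilbertType R).

Lemma lin_indep_ord n (v : 'I_n -> H) (c : 'I_n -> R[i]) : lin_indep v ->
  \sum_i c i *: v i = 0 -> forall i, c i = 0.
Proof.
move=> vli c0 i; apply: (vli (index_enum 'I_n)) => //.
  exact: index_enum_uniq.
exact: mem_index_enum.
Qed.

Lemma lin_indep_comp (I J : countType) (v : J -> H) (h : I -> J) :
  injective h -> lin_indep v -> lin_indep (v \o h).
Proof.
move=> hinj vli s c sU c0 i is_.
(* d carries the coefficient of k to h k *)
pose d j :=
  if [pick x : seq_sub s | h (ssval x) == j] is Some x then c (ssval x) else 0.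
have dh k : k \in s -> d (h k) = c k.
  move=> ks; rewrite /d; case: pickP => [x /eqP/hinj -> //|/(_ (SeqSub ks))].
  by rewrite eqxx.
rewrite -dh //; apply: (vli (map h s)); rewrite ?map_inj_uniq ?mem_map //.
by rewrite big_map -[RHS]c0; apply: eq_big_seq => k ks; rewrite dh.
Qed.

Lemma lin_indep_span_leq m n (v : 'I_m -> H) (w : 'I_n -> H) (W : set H) :
  lin_indep v -> spans w W -> (forall i, W (v i)) -> (m <= n)%N.
Proof.
move=> vli -> vW; rewrite leqNgt; apply/negP => nm.
have /choice[a aP] : forall i, exists a : 'I_n -> R[i], \sum_j a j *: w j = v i.
  by move=> i; have [a _ <-] := vW i; exists a.
have [c [[k ck] ca]] := ex_row_kernel a nm.
move/negP: ck; apply; apply/eqP; apply: (lin_indep_ord vli).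
under eq_bigr => i _ do rewrite -aP scaler_sumr.
rewrite exchange_big /= big1 // => j _.
by under eq_bigr => i _ do rewrite scalerA; rewrite -scaler_suml ca scale0r.
Qed.

Lemma hdim_finite n (v : 'I_n -> H) (W : set H) :
  lin_indep v -> spans v W -> hdim W = EFinite n.
Proof.
move=> vli vW; apply: least_orE => [|k [w wli wW]]; first by exists v.
apply: (lin_indep_span_leq vli wW) => i; rewrite vW.
exists (fun j => (j == i)%:R) => //; rewrite (bigD1 i) //= eqxx scale1r.
by rewrite big1 ?addr0 // => j /negPf ->; rewrite scale0r.
Qed.

Lemma hdim_infinite (v : nat -> H) (W : set H) :
  lin_indep v -> (forall k, W (v k)) -> hdim W = EInfinite.
Proof.
move=> vli vW; apply: least_or_none => n [w wli wW].
have := lin_indep_span_leq (lin_indep_comp (@ord_inj n.+1) vli) wW.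
by move=> /(_ (fun i => vW i)); rewrite ltnn.
Qed.

End Dimension.

(** * Orthonormal bases and equivalent inner products *)
Section OrthonormalBases.
Variables (R : realType) (H : hilbertType R).
Local Notation nsq := (qf (@inner R H)).
Local Notation iH := (@inner_semi_inner R H).

Lemma orthonormal_lin_indep (b : H -> H -> R[i]) (J : countType) (f : J -> H) :
  semi_inner b -> (forall i j, b (f i) (f j) = (i == j)%:R) -> lin_indep f.
Proof.
move=> hb fo s c sU c0 j js.
have := si0l hb (f j).
rewrite -c0 (si_suml hb) (bigD1_seq j) //= big1 => [|i ij].
  by rewrite (siZl hb) fo eqxx mulr1 addr0.
by rewrite (siZl hb) fo (negPf ij) mulr0.
Qed.

(** The difference is orthogonal to every f k, so Parseval's identity makes it
    a null vector. *)
Lemma orthonormal_expansion (b : H -> H -> R[i]) n (f : 'I_n -> H) x :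
  semi_inner b -> orthonormal_basis b f ->
  qf b (x - \sum_k b x (f k) *: f k) = 0.
Proof.
move=> hb [fo fP]; have := fP (x - \sum_k b x (f k) *: f k).
rewrite esum1 => [[<-]//|k _]; congr (_ %:E).
rewrite (siBl hb) (si_suml hb) (bigD1 k) //= big1 => [|i ik].
  by rewrite (siZl hb) fo eqxx mulr1 addr0 subrr sqn0.
by rewrite (siZl hb) fo (negPf ik) mulr0.
Qed.

Lemma orthonormal_basis_eq (b : H -> H -> R[i]) (J : countType) (f : J -> H)
    x y :
  semi_inner b -> coercive b -> orthonormal_basis b f ->
  (forall k, b x (f k) = b y (f k)) -> x = y.
Proof.
move=> hb cb [_ fP] xy; apply/eqP; rewrite -subr_eq0; apply/eqP.
apply: (coercive_eq0 cb); have := fP (x - y).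
by rewrite esum1 => [[<-]//|k _]; rewrite (siBl hb) xy subrr sqn0.
Qed.

Hypotheses (Hsep : separable_space H) (Hinf : hdim [set: H] = EInfinite).

Lemma dominated_orthonormal_basis (b : H -> H -> R[i]) (B : R) :
  semi_inner b -> 0 < B -> (forall x, qf b x <= B * nsq x) ->
  (exists n (f : 'I_n -> H), orthonormal_basis b f) \/
  (exists f : nat -> H, orthonormal_basis b f).
Proof.
move=> hb B0 bB; have [y ydense] := separable_seq Hsep.
apply: (orthonormal_basis_exists hb (y := y)) => x e e0.
have [n xn] := ydense x _ (divr_gt0 e0 B0); exists n.
by apply: le_lt_trans (bB _) _; rewrite mulrC -ltr_pdivlMr.
Qed.

Lemma orthonormal_basis_nat (b : H -> H -> R[i]) :
  semi_inner b -> coercive b -> exists f : nat -> H, orthonormal_basis b f.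
Proof.
move=> hb cb; have [A [B [_ B0 AB]]] := cb.
have [|[n [f fB]]|//] := @dominated_orthonormal_basis b B hb B0.
  by move=> x; have [_] := AB x.
have fli : lin_indep f by apply: orthonormal_lin_indep hb _; case: fB.
have := hdim_finite fli; rewrite /spans => /(_ setT) hfin.
have : hdim [set: H] = EFinite n.
  apply: hfin; apply/seteqP; split => // x _; exists (fun k => b x (f k)) => //.
  apply/esym/eqP; rewrite -subr_eq0; apply/eqP/(coercive_eq0 cb).
  exact: orthonormal_expansion.
by rewrite Hinf.
Qed.

(** Riesz-Fischer provides the vector with prescribed coordinates; uniqueness
    of coordinates makes the map linear. *)
Lemma coordinate_map (b1 b2 : H -> H -> R[i]) (f1 f2 : nat -> H) :
  semi_inner b1 -> semi_inner b2 -> coercive b2 ->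
  orthonormal_basis b1 f1 -> orthonormal_basis b2 f2 ->
  exists U : {linear H -> H}, forall x k, b2 (U x) (f2 k) = b1 x (f1 k).
Proof.
move=> hb1 hb2 cb2 [f1o f1P] f2B.
have [f2o f2P] := f2B.
have f1orth i j : i != j -> b1 (f1 i) (f1 j) = 0.
  by move=> /negPf ij; rewrite f1o ij.
have f1norm x n : b1 x (f1 n) * b1 (f1 n) (f1 n) = b1 x (f1 n).
  by rewrite f1o eqxx mulr1.
have Uex x : exists z, forall k, b2 z (f2 k) = b1 x (f1 k).
  have [i j ij|i|N|z zP] :=
    @riesz_fischer _ _ b2 f2 (fun k => b1 x (f1 k)) (qf b1 x) hb2 cb2.
  - by rewrite f2o (negPf ij).
  - by rewrite /qf f2o eqxx.
  - rewrite -lecR rmorph_sum qfE // (eq_bigr _ (fun k _ => sqnE _)).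
    exact: (si_bessel_le hb1 f1orth f1norm).
  by exists z => k; rewrite zP f2o eqxx mulr1.
have /choice[U UP] := Uex.
have Ulin : linear U.
  move=> a x y; apply: (orthonormal_basis_eq hb2 cb2 f2B) => k.
  by rewrite UP (siP hb1) (siP hb2) !UP.
have [L LU] := linear_pack Ulin.
by exists L => x k; rewrite LU UP.
Qed.

(** Both forms have an orthonormal basis indexed by nat, as the space is
    infinite-dimensional; U maps one basis to the other.  This replaces the
    square root of the operator that represents b. *)
Theorem coercive_isometry (b : H -> H -> R[i]) :
  semi_inner b -> coercive b ->
  exists U W : {linear H -> H},
    [/\ bounded_op U, bounded_op W, cancel U W, cancel W U &
        forall x, qf b (U x) = nsq x].
Proof.
move=> hb cb; have [A [B [A0 B0 AB]]] := cb.
have [e eB] := orthonormal_basis_nat iH (@coercive_inner R H).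
have [f fB] := orthonormal_basis_nat hb cb.
have [U UP] := coordinate_map iH hb cb eB fB.
have [W WP] := coordinate_map hb iH (@coercive_inner R H) fB eB.
have UW : cancel U W.
  move=> x; apply: (orthonormal_basis_eq iH (@coercive_inner R H) eB) => k.
  by rewrite WP UP.
have WU : cancel W U.
  by move=> x; apply: (orthonormal_basis_eq hb cb fB) => k; rewrite UP WP.
have Uq x : qf b (U x) = nsq x.
  apply: EFin_inj; have [_ <-] := fB; have [_ <-] := eB.
  by apply: eq_esum => k _; rewrite UP.
exists U, W; split => //.
  apply/bounded_opP; exists A^-1 => [|x]; first by rewrite invr_gt0.
  by rewrite ler_pdivlMl // -(Uq x); exact: (AB _).1.
apply/bounded_opP; exists B => // x.
by rewrite -(Uq (W x)) WU; exact: (AB _).2.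
Qed.

End OrthonormalBases.

(** * Sums along orbits *)
Lemma esum_nat_recl (R : realType) (a : nat -> \bar R) :
  (forall n, (0 <= a n)%E) ->
  (\esum_(n in [set: nat]) a n = a 0%N + \esum_(n in [set: nat]) a n.+1)%E.
Proof.
move=> a0; rewrite (esumID [set 0%N]) // !setTI esum_set1 //; congr (_ + _)%E.
apply: reindex_esum; split; [by []|by move=> m n _ _ []|].
by case=> [/(_ erefl)//|n _]; exists n.
Qed.

Section Orbits.
Variables (R : realType) (H : hilbertType R).
Local Notation nsq := (qf (@inner R H)).
Local Notation iH := (@inner_semi_inner R H).
Hypothesis Hsep : separable_space H.
Variable T : {linear H -> H}.
Hypothesis Tb : bounded_op T.
Local Notation Ts := (adjoint T).

Lemma sqn_inner_sym (x y : H) : sqn (inner x y) = sqn (inner y x).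
Proof. by rewrite (siC iH) sqnC. Qed.

Section Family.
Variables (J : countType) (v : J -> H).

Definition analysis_sum (y : H) : \bar R :=
  (\esum_(j in [set: J]) (sqn (inner y (v j)))%:E)%E.

Definition orbit_sum (y : H) : \bar R :=
  (\esum_(k in [set: J * nat]) (sqn (inner y (orbits T v k)))%:E)%E.

Lemma analysis_sum_ge0 y : (0 <= analysis_sum y)%E.
Proof. by apply: esum_ge0 => j _; rewrite lee_fin sqn_ge0. Qed.

Lemma orbit_sumE y :
  orbit_sum y = (\esum_(n in [set: nat]) analysis_sum (iter n Ts y))%E.
Proof.
rewrite /analysis_sum.
rewrite (esum_esum (a := fun n j => (sqn (inner (iter n Ts y) (v j)))%:E));
  last first.
  by move=> n j _ _; rewrite lee_fin sqn_ge0.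
rewrite (_ : _ `*`` _ = [set: nat * J]); last by apply/seteqP; split.
rewrite /orbit_sum (reindex_esum [set: nat * J] _ (fun p => (p.2, p.1)));
  last first.
  split; [by []|by move=> [n j] [m i] _ _ [-> ->]|].
  by move=> [j n] _; exists (n, j).
apply: eq_esum => -[n j] _ /=.
by rewrite /orbits /= sqn_inner_sym adjoint_iter // sqn_inner_sym.
Qed.

(** The terms of time n + 1 at y are the terms of time n at the adjoint's
    image of y. *)
Lemma orbit_sum_rec y : orbit_sum y = (analysis_sum y + orbit_sum (Ts y))%E.
Proof.
rewrite !orbit_sumE esum_nat_recl => [|n]; last exact: analysis_sum_ge0.
by congr (_ + _)%E; apply: eq_esum => n _; rewrite iterSr.
Qed.

Lemma parseval_analysis : is_parseval_frame (orbits T v) ->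
  forall y, analysis_sum y = (nsq y - nsq (Ts y))%:E.
Proof.
move=> vP y; have SP z : orbit_sum z = (nsq z)%:E.
  by rewrite -rnorm_sqr; exact: vP.
have := orbit_sum_rec y; rewrite !SP => e.
by rewrite EFinB e addeK.
Qed.

Lemma parseval_contraction : is_parseval_frame (orbits T v) ->
  forall y, nsq (Ts y) <= nsq y.
Proof.
move=> /parseval_analysis vP y; have := analysis_sum_ge0 y.
by rewrite vP lee_fin subr_ge0.
Qed.

Lemma strongly_stableP (S : H -> H) : strongly_stable S <->
  forall y e, 0 < e -> exists N, forall n, (N <= n)%N -> nsq (iter n S y) < e.
Proof.
split=> [Sst y e e0|Sst y].
  have s0 : 0 < (Num.sqrt e)%:C%C by rewrite ltcR sqrtr_gt0.
  have /cvg_ballP/(_ _ s0)[N _ SN] := Sst y.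
  exists N => n /SN /(nsq_ball s0); rewrite sqr_sqrtr ?ltW // => h.
  by move: h; rewrite sub0r (qfN iH).
apply/cvg_ballP => e e0.
have re0 : 0 < complex.Re e by rewrite -ltcR Re_ge0K ?ltW.
have [N SN] := Sst y _ (exprn_gt0 2 re0).
exists N => // n /= /SN; rewrite -{2}(Re_ge0K (ltW e0)) -(qfN iH) -sub0r.
exact: ball_nsq.
Qed.

Lemma analysis_parseval : strongly_stable Ts ->
  (forall y, analysis_sum y = (nsq y - nsq (Ts y))%:E) ->
  is_parseval_frame (orbits T v).
Proof.
move=> /strongly_stableP Tst aP y.
suff : orbit_sum y = (nsq y)%:E by rewrite -rnorm_sqr.
pose u n := nsq (iter n Ts y) - nsq (iter n.+1 Ts y).
have u0 n : 0 <= u n by rewrite -lee_fin -aP analysis_sum_ge0.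
have uS N : \sum_(n < N) u n = nsq y - nsq (iter N Ts y).
  elim: N => [|N IHN]; first by rewrite big_ord0 subrr.
  by rewrite big_ord_recr /= IHN /u addrA subrK.
rewrite orbit_sumE (eq_esum (b := fun n => (u n)%:E)) => [|n _]; last exact: aP.
apply: esum_nat_eq => // [N|e e0].
  by rewrite uS gerBl (qf_ge0 iH).
have [N yN] := Tst y e e0; exists N.
by rewrite uS lerD2l lerN2 ltW ?yN.
Qed.

End Family.

End Orbits.

(** * The defect of a contraction *)
Lemma finite_rank_bound (R : realType) (H : hilbertType R) (I : Type)
    (r : seq I) (f g : I -> H) :
  exists2 K : R, 0 <= K & forall x,
    qf (@inner R H) (\sum_(k <- r) inner x (f k) *: g k) <=
    K * qf (@inner R H) x.
Proof.
have iH := @inner_semi_inner R H.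
elim: r => [|k r [K K0 IH]].
  by exists 0 => // x; rewrite big_nil (qf0 iH) mul0r.
exists (2 * (qf (@inner R H) (f k) * qf (@inner R H) (g k) + K)) => [|x].
  by rewrite mulr_ge0 // addr_ge0 // mulr_ge0 // (qf_ge0 iH).
rewrite big_cons; apply: le_trans (qfD_le iH _ _) _.
rewrite -mulrA ler_pM2l // mulrDl lerD // (qfZ iH) [leRHS]mulrAC.
by rewrite ler_wpM2r ?(qf_ge0 iH) // mulrC qf_cauchy_schwarz.
Qed.

Section Defect.
Variables (R : realType) (H : hilbertType R).
Local Notation nsq := (qf (@inner R H)).
Local Notation iH := (@inner_semi_inner R H).
Hypothesis Hsep : separable_space H.
Variable T : {linear H -> H}.
Hypothesis Tcontr : contraction_op T.
Local Notation Ts := (adjoint T).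

Let Tb : bounded_op T.
Proof. exact: le_lt_trans Tcontr (ltry _). Qed.

Definition defect (x : H) : H := x - T (Ts x).
Definition defect_form (x y : H) : R[i] := inner (defect x) y.
Local Notation D := defect.
Local Notation Db := defect_form.

Lemma defect_formE x y : Db x y = inner x y - inner (Ts x) (Ts y).
Proof. by rewrite /Db /D (siBl iH) adjointP. Qed.

Lemma inner_defect x y : inner x (D y) = Db x y.
Proof.
by rewrite defect_formE (siC iH) -/(Db y x) defect_formE rmorphB /= -!(siC iH).
Qed.

Lemma defect_linear a x y : D (a *: x + y) = a *: D x + D y.
Proof.
rewrite /D (adjoint_linear Hsep Tb) linearP scalerBr opprD.
by rewrite addrACA.
Qed.

Lemma qf_defect_form x : qf Db x = nsq x - nsq (Ts x).
Proof. by rewrite /qf defect_formE ReD ReN. Qed.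

Lemma defect_form_semi_inner : semi_inner Db.
Proof.
split=> [a x y z|x y|x].
- by rewrite /Db defect_linear (siP iH).
- by rewrite -inner_defect (siC iH).
rewrite defect_formE -!(qfE iH) subr_ge0 lecR -[leRHS]mul1r.
apply: (adjoint_bound Hsep) => // z; rewrite mul1r.
exact: (contraction_opP T).1.
Qed.
Local Notation iD := defect_form_semi_inner.

Lemma defect_form_dominated x : qf Db x <= 1 * nsq x.
Proof. by rewrite mul1r qf_defect_form gerBl (qf_ge0 iH). Qed.

Lemma parseval_defectP (J : countType) (v : J -> H) : strongly_stable Ts ->
  is_parseval_frame (orbits T v) <->
  forall y, analysis_sum v y = (qf Db y)%:E.
Proof.
move=> Tst; split=> [vP y|vP].
  by rewrite qf_defect_form (parseval_analysis Hsep Tb).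
by apply: (analysis_parseval Hsep Tb) => // y; rewrite vP qf_defect_form.
Qed.

Section Basis.
Variables (J : countType) (f : J -> H).
Hypothesis fB : orthonormal_basis Db f.

Let fo i j : Db (f i) (f j) = (i == j)%:R.
Proof. by case: fB. Qed.

Lemma defect_basis_parseval : strongly_stable Ts ->
  parseval_generators T (D \o f).
Proof.
move=> Tst; split=> [j|].
  apply/eqP => /= e; have := fo j j; rewrite -inner_defect e (si0r iH) eqxx.
  by move=> /eqP; rewrite eq_sym oner_eq0.
apply/parseval_defectP => // y; have [_ <-] := fB.
by apply: eq_esum => j _; rewrite /= inner_defect.
Qed.

Lemma defect_basis_lin_indep : lin_indep (D \o f).
Proof.
move=> s c sU c0 j js.
have := si0l iH (f j); rewrite -c0 (si_suml iH) (bigD1_seq j) //= big1.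
  by rewrite (siZl iH) -/(Db _ _) fo eqxx mulr1 addr0.
by move=> i ij; rewrite (siZl iH) -/(Db _ _) fo (negPf ij) mulr0.
Qed.

Lemma defect_basis_closure j : closure (defect_range T) ((D \o f) j).
Proof. by apply: subset_closure; exists (f j). Qed.

End Basis.

Lemma defect_sum (I : Type) (r : seq I) (c : I -> R[i]) (g : I -> H) :
  D (\sum_(i <- r) c i *: g i) = \sum_(i <- r) c i *: D (g i).
Proof.
elim/big_rec2: _ => [|i u w _ <-]; last by rewrite defect_linear.
by have := defect_linear (-1) 0 0; rewrite scaler0 addr0 scaleN1r addNr.
Qed.

Lemma defect_expansion n (f : 'I_n -> H) x : orthonormal_basis Db f ->
  D x = \sum_k Db x (f k) *: D (f k).
Proof.
move=> fB; rewrite -defect_sum; set p := \sum_k _.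
have Dxp : D (x - p) = 0.
  apply: inner_eq0 => y; rewrite -/(Db _ _); apply: (si_null iD).
  by rewrite -(qfE iD) (orthonormal_expansion x iD fB).
have -> : D x = D (1 *: p + (x - p)) by rewrite scale1r addrC subrK.
by rewrite defect_linear scale1r Dxp addr0.
Qed.

Lemma defect_basis_span n (f : 'I_n -> H) :
  orthonormal_basis Db f -> spans (D \o f) (closure (defect_range T)).
Proof.
move=> fB; apply/seteqP; split=> [z zcl|_ [c _ <-]]; last first.
  by apply: subset_closure; exists (\sum_k c k *: f k) => //; exact: defect_sum.
(* the projection along the dual system f fixes the range of D and is
   continuous, so it fixes the closure of that range *)
pose P x := \sum_k inner x (f k) *: D (f k).
exists (fun k => inner z (f k)) => //; rewrite -/(P z).
have PB x y : P (x - y) = P x - P y.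
  rewrite /P -sumrB; apply: eq_bigr => k _.
  by rewrite (siBl iH) scalerBl.
have [K K0 PK] := finite_rank_bound (index_enum 'I_n) f (D \o f).
apply/eqP; rewrite -subr_eq0; apply/eqP/nsq_eq0/eqP.
rewrite eq_le (qf_ge0 iH) andbT; apply/ler_addgt0Pr => e e0; rewrite add0r.
have M0 : 0 < 2 * (K + 1) by rewrite mulr_gt0 // ltr_wpDl.
have s0 : 0 < (Num.sqrt (e / (2 * (K + 1))))%:C%C.
  by rewrite ltcR sqrtr_gt0 divr_gt0.
have [_ [[x _ <-] /(nsq_ball s0)]] := zcl _ (nbhsx_ballx z _ s0).
rewrite -/(D x) sqr_sqrtr ?(ltW (divr_gt0 e0 M0)) // ltr_pdivlMr // => zx.
have -> : P z - z = P (z - D x) - (z - D x).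
  have PD : P (D x) = D x by rewrite [RHS](defect_expansion x fB).
  by rewrite PB PD; move: (P z) (D x) => u w; rewrite opprB addrA subrK.
apply: le_trans (ltW zx); apply: le_trans (qfD_le iH _ _) _.
have := PK (z - D x); rewrite (qfN iH) -/(P _).
by move: (qf _ (P _)) (qf _ (z - _)) => p q pq; lra.
Qed.

(** If n were less than m, some non-zero combination y of the f i would be
    orthogonal to the n vectors w j, so that the defect form would vanish
    at y. *)
Lemma defect_basis_minimal m n (f : 'I_m -> H) (w : 'I_n -> H) :
  (forall i j, Db (f i) (f j) = (i == j)%:R) ->
  is_parseval_frame (orbits T w) -> (m <= n)%N.
Proof.
move=> fo wP; rewrite leqNgt; apply/negP => nm.
have [c [[k ck] cw]] := ex_row_kernel (fun k j => inner (f k) (w j)) nm.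
pose y := \sum_k c k *: f k.
have : qf Db y = 0.
  apply: EFin_inj; rewrite qf_defect_form -(parseval_analysis Hsep Tb wP).
  apply: esum1 => j _; rewrite /y (si_suml iH).
  by under eq_bigr do rewrite (siZl iH); rewrite cw sqn0.
move=> y0; move/negP: ck; apply; apply/eqP.
have : Db y (f k) = 0 by apply: (si_null iD); rewrite -(qfE iD) y0.
rewrite (si_suml iD) (bigD1 k) //= big1 => [|i ik].
  by rewrite (siZl iD) fo eqxx mulr1 addr0.
by rewrite (siZl iD) fo (negPf ik) mulr0.
Qed.

Theorem defect_index : strongly_stable Ts ->
  let d := hdim (closure (defect_range T)) in
  attained_lin_indep (parseval_generators T) d /\
  forall n (w : 'I_n -> H), parseval_generators T w -> enat_le d (EFinite n).
Proof.
move=> Tst.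
have [[n [f fB]]|[f fB]] :=
    dominated_orthonormal_basis Hsep iD ltr01 defect_form_dominated.
  have fli := defect_basis_lin_indep fB.
  rewrite /= (hdim_finite fli (defect_basis_span fB)); split.
    by exists (D \o f) => //; exact: defect_basis_parseval.
  by move=> m w [_]; apply: defect_basis_minimal; case: fB.
have fli := defect_basis_lin_indep fB.
have fcl k : closure (defect_range T) ((D \o f) k).
  exact: defect_basis_closure.
rewrite /= (hdim_infinite fli fcl); split.
  by exists (D \o f) => //; exact: defect_basis_parseval.
move=> n w [_ wP]; have [fo _] := fB.
suff : (n.+1 <= n)%N by rewrite ltnn.
apply: (defect_basis_minimal (f := fun i : 'I_n.+1 => f i)) wP => i j.
by rewrite fo.
Qed.

End Defect.

(** * Limits of semi-inner products *)
Lemma semi_inner_sum (C : numClosedFieldType) (E : lmodType C) (I : Type)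
    (r : seq I) (b : I -> E -> E -> C) : (forall i, semi_inner (b i)) ->
  semi_inner (fun x y => \sum_(i <- r) b i x y).
Proof.
move=> hb; split=> [a x y z|x y|x].
- rewrite mulr_sumr -big_split; apply: eq_bigr => i _; exact: (siP (hb i)).
- by rewrite rmorph_sum; apply: eq_bigr => i _; rewrite (siC (hb i)).
by apply: sumr_ge0 => i _; exact: si_ge0.
Qed.

Lemma cvg_conjC (C : numClosedFieldType) (u : nat -> C) (l : C) :
  u @ \oo --> l -> (fun n => (u n)^*) @ \oo --> l^*.
Proof.
move=> /cvgrPdist_lt ul; apply/cvgrPdist_lt => e /ul.
by apply: filterS => n; rewrite -rmorphB norm_conjC.
Qed.

(** By polarization, convergence on the diagonal forces convergence
    everywhere, and the identities of a semi-inner product pass to the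
    limit. *)
Lemma semi_inner_lim (C : numClosedFieldType) (E : lmodType C)
    (b : nat -> E -> E -> C) (q : E -> C) :
  (forall n, semi_inner (b n)) -> (forall x, 0 <= q x) ->
  (forall x, (fun n => b n x x) @ \oo --> q x) ->
  exists2 b', semi_inner b' & forall x, b' x x = q x.
Proof.
move=> hb q0 bq.
pose b' x y := 4^-1 * (q (x + y) - q (x - y) +
                       'i * (q (x + 'i *: y) - q (x - 'i *: y))).
have bb' x y : (fun n => b n x y) @ \oo --> b' x y.
  under eq_cvg => n do rewrite (si_polarization (hb n)).
  apply: cvgM; first exact: cvg_cst.
  apply: cvgD; first by apply: cvgB; exact: bq.
  by apply: cvgM; [exact: cvg_cst|apply: cvgB; exact: bq].
have lim_uniq (u v : nat -> C) (l m : C) :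
    u @ \oo --> l -> v @ \oo --> m -> u =1 v -> l = m.
  move=> ul vm /funext uv; rewrite uv in ul.
  exact: (@cvg_unique C (@norm_hausdorff _ C) (v @ \oo) _ l m ul vm).
have b'q x : b' x x = q x by exact: (lim_uniq _ _ _ _ (bb' x x) (bq x)).
exists b' => //; split=> [a x y z|x y|x]; last by rewrite b'q.
- have lim_r : (fun n => a * b n x z + b n y z) @ \oo -->
      a * b' x z + b' y z.
    by apply: cvgD => //; apply: cvgM => //; exact: cvg_cst.
  by apply: (lim_uniq _ _ _ _ (bb' _ _) lim_r) => n; rewrite (siP (hb n)).
- apply: (lim_uniq _ _ _ _ (bb' _ _) (cvg_conjC (bb' _ _))) => n.
  by rewrite (siC (hb n)).
Qed.

Lemma cvg_real_complex (R : realType) (u : nat -> R) (l : R)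
    (C := R[i] : numClosedFieldType) :
  u @ \oo --> l -> (fun n => (u n)%:C%C : C) @ \oo --> (l%:C%C : C).
Proof.
move=> /cvgrPdist_lt ul; apply/cvgrPdist_lt => e e0.
have re0 : 0 < complex.Re e by rewrite -ltcR Re_ge0K ?ltW.
have [N _ uN] := ul _ re0; exists N => // n /uN.
rewrite -ltcR Re_ge0K ?ltW //; apply: le_lt_trans.
by rewrite -rmorphB normc_def /= [0 ^+ 2]expr0n addr0 sqrtr_sqr.
Qed.

Lemma esum_nat_cvg (R : realType) (u : nat -> R) (l : R) :
  (forall n, 0 <= u n) -> (\esum_(n in [set: nat]) (u n)%:E = l%:E)%E ->
  (fun N => \sum_(n < N) u n) @ \oo --> l.
Proof.
move=> u0; rewrite -nneseries_esumT => [|n]; last by rewrite lee_fin.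
move=> ul; have : (fun N => (\sum_(0 <= n < N) (u n)%:E)%E) @ \oo --> l%:E.
  by rewrite -ul; apply: is_cvg_nneseries => n _ _; rewrite lee_fin.
move=> /fine_cvg; apply: cvg_trans; apply: near_eq_cvg.
by apply: nearW => N /=; rewrite sumEFin /= big_mkord.
Qed.

Lemma semi_inner_rank1 (R : realType) (H : hilbertType R) (u : H) :
  semi_inner (fun x y : H => inner x u * (inner y u)^*).
Proof.
have iH := @inner_semi_inner R H; split=> [a x y z|x y|x].
- by rewrite (siP iH) mulrDl mulrA.
- by rewrite rmorphM /= conjCK mulrC.
- by rewrite -normCK exprn_ge0.
Qed.

(** * Similar operators *)
Section Similarity.
Variables (R : realType) (H : hilbertType R).
Local Notation nsq := (qf (@inner R H)).
Local Notation iH := (@inner_semi_inner R H).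
Hypothesis Hsep : separable_space H.

Lemma bounded_comp (S T : {linear H -> H}) :
  bounded_op S -> bounded_op T -> bounded_op (S \o T).
Proof.
move=> /bounded_opP[M M0 SM] /bounded_opP[N N0 TN].
apply/(bounded_opP (S \o T)); exists (M * N) => [|x]; first exact: mulr_gt0.
by apply: le_trans (SM _) _; rewrite -mulrA ler_wpM2l ?TN // ltW.
Qed.


Lemma similar_iter (S T : H -> H) (V W : H -> H) : cancel V W ->
  (forall x, V (S (W x)) = T x) ->
  forall n x, iter n T (V x) = V (iter n S x).
Proof.
by move=> VW ST n x; elim: n => //= n ->; rewrite -ST VW.
Qed.

Lemma inner_adjoint (V : {linear H -> H}) x y : bounded_op V ->
  inner x (V y) = inner (adjoint V x) y.
Proof. by move=> Vb; rewrite (siC iH) adjointP // -(siC iH). Qed.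

Lemma adjoint_cancel (V W : {linear H -> H}) : bounded_op V -> bounded_op W ->
  cancel V W -> cancel (adjoint W) (adjoint V).
Proof.
by move=> Vb Wb VW x; apply: inner_eq => z; rewrite -!adjointP // VW.
Qed.

Lemma similar_adjoint_stable (S T : {linear H -> H}) :
  bounded_op S -> bounded_op T -> similar_ops S T ->
  strongly_stable (adjoint T) -> strongly_stable (adjoint S).
Proof.
move=> Sb Tb [V [W [Vb Wb VW WV ST]]] /strongly_stableP Tst.
apply/strongly_stableP => y e e0.
have /bounded_opP[M M0 VM] := Vb.
have [N TN] := Tst (adjoint W y) _ (divr_gt0 e0 M0); exists N => n /TN.
have -> : iter n (adjoint S) y = adjoint V (iter n (adjoint T) (adjoint W y)).
  apply: inner_eq => z; rewrite -adjoint_iter // -adjointP // -adjoint_iter //.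
  by rewrite -adjointP // (similar_iter VW ST) VW.
rewrite ltr_pdivlMr // mulrC; apply: le_lt_trans.
by apply: (adjoint_bound Hsep) => //; exact: ltW.
Qed.

(** The analysis sum at y is the square of V' y, where the adjoint V' of V is
    bounded above and below. *)
Lemma similar_generators (S T : {linear H -> H}) (V W : {linear H -> H})
    (J : countType) (w : J -> H) :
  bounded_op V -> bounded_op W -> cancel V W -> cancel W V ->
  (forall x, V (S (W x)) = T x) ->
  parseval_generators S w -> generators T (V \o w).
Proof.
move=> Vb Wb VW WV ST [w0 wP]; split=> [j|].
  by apply: contra_neq (w0 j) => /= Vw; rewrite -[w j]VW Vw linear0.
have sumE y : orbit_sum T (V \o w) y = (nsq (adjoint V y))%:E.
  rewrite -rnorm_sqr -[RHS]wP; apply: eq_esum => -[j n] _.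
  by rewrite /orbits /= (similar_iter VW ST) inner_adjoint.
have /bounded_opP[M M0 VM] := Vb; have /bounded_opP[N N0 WN] := Wb.
exists N^-1, M; split => // [|y]; first by rewrite invr_gt0.
move: (sumE y); rewrite /orbit_sum /sqn => ->.
rewrite rnorm_sqr !lee_fin; split.
  rewrite ler_pdivrMl // -{1}[y](adjoint_cancel Wb Vb WV).
  by apply: (adjoint_bound Hsep) => //; exact: ltW.
by apply: (adjoint_bound Hsep) => //; exact: ltW.
Qed.

Lemma lin_indep_linear_inj (V : {linear H -> H}) (J : countType) (w : J -> H) :
  injective V -> lin_indep w -> lin_indep (V \o w).
Proof.
move=> Vinj wli s c sU c0; apply: (wli s c sU); apply: Vinj.
rewrite linear0 linear_sum -[RHS]c0; apply: eq_bigr => j _.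
by rewrite linearZ.
Qed.

Lemma similar_attained (S T : {linear H -> H}) d : similar_ops S T ->
  attained_lin_indep (parseval_generators S) d ->
  attained_lin_indep (generators T) d.
Proof.
move=> [V [W [Vb Wb VW WV ST]]].
case: d => [n|] [w wS wli]; exists (V \o w).
1,3: exact: (similar_generators Vb Wb VW WV ST).
all: exact/lin_indep_linear_inj/wli/can_inj/VW.
Qed.

Hypothesis Hinf : hdim [set: H] = EInfinite.

(** An operator that contracts an equivalent norm coming from an inner product
    is similar to a contraction for the original norm. *)
Lemma coercive_contraction (T : {linear H -> H}) (b : H -> H -> R[i]) :
  semi_inner b -> coercive b -> (forall x, qf b (T x) <= qf b x) ->
  exists Q : {linear H -> H}, contraction_op Q /\ similar_ops Q T.
Proof.
move=> hb cb bT.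
have [U [W [Ub Wb UW WU Uq]]] := coercive_isometry Hsep Hinf hb cb.
exists (W \o (T \o U)); split.
  apply/contraction_opP => x; rewrite -Uq /= WU.
  by apply: le_trans (bT _) _; rewrite Uq.
by exists U, W; split => // x /=; rewrite !WU.
Qed.

(** The similarity V pulls the inner product of the other space back to an
    equivalent inner product that T contracts. *)
Lemma similar_to_contraction_same_space (T : {linear H -> H}) :
  similar_to_contraction T ->
  exists Q : {linear H -> H}, contraction_op Q /\ similar_ops Q T.
Proof.
move=> [H' [Q [/contraction_opP Qc [V [W [/bounded_opP[M M0 VM]
  /bounded_opP[N N0 WN] VW WV TQ]]]]]].
have iH' := @inner_semi_inner R H'.
pose b x y := inner (V x) (V y).
have hb : semi_inner b.
  split=> [a x y z|x y|x]; rewrite /b; last exact: (si_ge0 iH').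
    by rewrite linearP (siP iH').
  exact: (siC iH').
apply: (coercive_contraction hb) => [|x]; last first.
  by rewrite /qf /b -[T x]VW -[x in T x]VW WV TQ; exact: Qc.
exists N^-1, M; split => // [|x]; first by rewrite invr_gt0.
by split; [rewrite ler_pdivrMl // -{1}[x]VW; exact: WN|exact: VM].
Qed.

(** The partial sums over the time m are semi-inner products, finite sums of
    forms of rank one, and they converge on the diagonal by the frame
    inequality. *)
Lemma generators_form (T : {linear H -> H}) n (v : 'I_n -> H) :
  bounded_op T -> is_frame (orbits T v) ->
  exists b, [/\ semi_inner b, coercive b & forall y,
    orbit_sum T v y = (qf b y)%:E].
Proof.
move=> Tb [A [B [A0 B0 vF]]].
have S_fin y : orbit_sum T v y \is a fin_num.
  have [_ yB] := vF y; rewrite ge0_fin_numE; last first.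
    by apply: esum_ge0 => k _; rewrite lee_fin sqn_ge0.
  exact: le_lt_trans yB (ltry _).
pose q y := fine (orbit_sum T v y).
have qE y : orbit_sum T v y = (q y)%:E by rewrite fineK.
pose u m y := \sum_(j < n) sqn (inner y (iter m T (v j))).
have u0 m y : 0 <= u m y by apply: sumr_ge0 => j _; exact: sqn_ge0.
have uq y : (\esum_(m in [set: nat]) (u m y)%:E = (q y)%:E)%E.
  rewrite -qE orbit_sumE //; apply: eq_esum => m _.
  rewrite /analysis_sum esum_ord => [|j]; last exact: sqn_ge0.
  congr (_ %:E); apply: eq_bigr => j _.
  by rewrite sqn_inner_sym adjoint_iter // sqn_inner_sym.
pose bN N x y := \sum_(m < N) \sum_(j < n)
  inner x (iter m T (v j)) * (inner y (iter m T (v j)))^*.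
have hbN N : semi_inner (bN N).
  do 2!apply: semi_inner_sum => ?; exact: semi_inner_rank1.
have bNq N x : bN N x x = (\sum_(m < N) u m x)%:C%C.
  rewrite rmorph_sum; apply: eq_bigr => m _; rewrite rmorph_sum.
  by apply: eq_bigr => j _ /=; rewrite sqnE normCK.
have [||b hb bq] := @semi_inner_lim _ _ bN (fun y => (q y)%:C%C) hbN.
- by move=> y; rewrite ler0c -lee_fin -uq esum_ge0 // => m _; rewrite lee_fin.
- move=> y; under eq_cvg => N do rewrite bNq.
  apply: (@cvg_real_complex R (fun N => \sum_(m < N) u m y)).
  exact: (esum_nat_cvg (u0^~ y) (uq y)).
have qb y : qf b y = q y by rewrite /qf bq.
exists b; split=> // [|y]; last by rewrite qb.
exists A, B; split=> // y; have := vF y; move: (qE y).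
by rewrite /orbit_sum /sqn => ->; rewrite !rnorm_sqr !lee_fin qb => -[].
Qed.

End Similarity.

(** * The two indices *)
Section FrameToParseval.
Variables (R : realType) (H : hilbertType R).
Local Notation nsq := (qf (@inner R H)).
Local Notation iH := (@inner_semi_inner R H).
Hypotheses (Hsep : separable_space H) (Hinf : hdim [set: H] = EInfinite).

(** Q is the adjoint of its adjoint, and taking adjoints preserves bounds. *)
Lemma contraction_adjoint (Q : {linear H -> H}) : bounded_op Q ->
  (forall y, nsq (adjoint Q y) <= nsq y) -> contraction_op Q.
Proof.
move=> Qb Qs; have [L LE] := linear_pack (adjoint_linear Hsep Qb).
apply/contraction_opP => x; rewrite -[leRHS]mul1r.
have <- : adjoint L x = Q x.
  by apply: adjoint_unique => y; rewrite LE -inner_adjoint.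
by apply: (adjoint_bound Hsep) => // y; rewrite LE mul1r.
Qed.

(** Q = U' T (U')^-1, where U intertwines the inner product of the space and
    the form of the frame. *)
Theorem generators_similar_parseval (T : {linear H -> H}) n (v : 'I_n -> H) :
  bounded_op T -> generators T v ->
  exists (Q : {linear H -> H}) (w : 'I_n -> H),
    [/\ contraction_op Q, similar_ops Q T & parseval_generators Q w].
Proof.
move=> Tb [v0 vF].
have [b [hb cb bq]] := generators_form Hsep Tb vF.
have [U [W [Ub Wb UW WU Uq]]] := coercive_isometry Hsep Hinf hb cb.
have [Us UsE] := linear_pack (adjoint_linear Hsep Ub).
have [Ws WsE] := linear_pack (adjoint_linear Hsep Wb).
have adj_b (V Vs : {linear H -> H}) : Vs =1 adjoint V -> bounded_op V ->
    bounded_op Vs.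
  move=> VsE /bounded_opP[M M0 VM]; apply/bounded_opP; exists M => // x.
  by rewrite VsE; apply: (adjoint_bound Hsep) => //; exact: ltW.
have Usb := adj_b _ _ UsE Ub; have Wsb := adj_b _ _ WsE Wb.
have UsWs : cancel Us Ws.
  by move=> x; rewrite WsE UsE (adjoint_cancel Hsep Wb Ub WU).
have WsUs : cancel Ws Us.
  by move=> x; rewrite WsE UsE (adjoint_cancel Hsep Ub Wb UW).
pose Q : {linear H -> H} := Us \o (T \o Ws).
have QT : similar_ops Q T.
  by exists Ws, Us; split => // x; rewrite /Q /= !UsWs.
have Qb : bounded_op Q := bounded_comp Usb (bounded_comp Tb Wsb).
have wP : is_parseval_frame (orbits Q (Us \o v)).
  move=> y; rewrite rnorm_sqr -Uq -bq; apply: eq_esum => -[j m] _.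
  have -> : orbits Q (Us \o v) (j, m) = Us (iter m T (v j)).
    exact: (similar_iter (S := T) (T := Q) UsWs).
  by rewrite UsE -adjointP.
exists Q, (Us \o v); split => //.
  exact: contraction_adjoint (parseval_contraction Hsep Qb wP).
by split=> // j; apply: contra_neq (v0 j) => /= e; rewrite -[v j]UsWs e linear0.
Qed.

(** Reduces the computation of an index to exhibiting an independent family of
    that size and bounding below the size of the finite families. *)
Lemma generator_indexE (G : forall J : countType, (J -> H) -> Prop) d :
  attained_lin_indep G d ->
  (forall n (w : 'I_n -> H), G 'I_n w -> enat_le d (EFinite n)) ->
  generator_index G = d.
Proof.
case: d => [n|] [v Gv _] Gmin.
  by apply: least_orE => [|k [w /Gmin]]; first by exists v.
rewrite /generator_index least_or_none => [|n [w /Gmin]//].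
by case: asboolP => // -[]; exists nat, v.
Qed.

End FrameToParseval.

Lemma enat_set_min (S : set enat) : S !=set0 -> exists d, is_min S d.
Proof.
move=> [d0 Sd0].
have [[n Sn]|Sinf] := pselect (exists n, S (EFinite n)); last first.
  have SE k : S k -> k = EInfinite.
    by case: k => // n Sn; case: Sinf; exists n.
  by exists EInfinite; split=> [|k /SE ->//]; rewrite -(SE _ Sd0).
have [m _ [Sm mmin]] := least_orP (P := fun n => S (EFinite n)) EInfinite Sn.
by exists (EFinite m); split=> // -[k /mmin|].
Qed.

Lemma enat_le_trans (a b c : enat) : enat_le a b -> enat_le b c -> enat_le a c.
Proof. by case: a b c => [m|] [n|] [k|] //=; exact: leq_trans. Qed.

Unset Implicit Arguments.

Theorem theorem1p3 (R : realType) (H : hilbertType R) (T : {linear H -> H})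
  (Hsep : separable_space H) (Hinf : hdim [set: H] = EInfinite)
  (Tbnd : bounded_op T) :
  (contraction_op T -> strongly_stable (adjoint T) ->
     parseval_frame_index T = hdim (closure (defect_range T)) /\
     attained_lin_indep (parseval_generators T) (parseval_frame_index T))
  /\
  (similar_to_contraction T -> strongly_stable (adjoint T) ->
     is_min
       [set d | exists Q : {linear H -> H},
          [/\ contraction_op Q, similar_ops Q T &
              d = hdim (closure (defect_range Q))]]
       (frame_index T) /\
     attained_lin_indep (generators T) (frame_index T)).
Proof.
split=> [Tc Tst|Tsc Tst].
  have [dA dmin] := defect_index Hsep Tc Tst.
  have -> : parseval_frame_index T = hdim (closure (defect_range T)).
    exact: generator_indexE.
  by [].
have [Q0 [Q0c Q0T]] := similar_to_contraction_same_space Hsep Hinf Tsc.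
have index (Q : {linear H -> H}) Qc (QT : similar_ops Q T) :=
  defect_index Hsep Qc (similar_adjoint_stable Hsep
    (le_lt_trans Qc (ltry 1)) Tbnd QT Tst).
set S := [set d | _].
have [d [[Q [Qc QT dE]] dmin]] : exists d, is_min S d.
  by apply: enat_set_min; exists (hdim (closure (defect_range Q0))), Q0.
have dA : attained_lin_indep (generators T) d.
  by rewrite dE; exact: (similar_attained Hsep QT (index Q Qc QT).1).
have -> : frame_index T = d.
  apply: generator_indexE => // n v vG.
  have [Q' [w [Q'c Q'T wG]]] := generators_similar_parseval Hsep Hinf Tbnd vG.
  have [_ /(_ n w wG)] := index Q' Q'c Q'T.
  by apply: enat_le_trans; apply: dmin; exists Q'.
by split=> //; split => //; exists Q.
Qed.
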